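(* Let $q\in(0,1)$ be fixed. Let $a_0,\ldots,a_n$ be polynomials (with complex coefficients) with $a_n\not\equiv0$. Then every transcendental entire solution $y$ to the Askey-Wilson difference equation $$a_n\mathcal{D}_q^ny+\cdots+a_1\mathcal{D}_qy+a_0y=0$$ has log-order at least $2$.
   Context: The Askey-Wilson operator $\mathcal{D}_q$: for $x\in\mathbb{C}$ write $x=\frac{z+z^{-1}}2$ and set $\hat x:=\frac{q^{1/2}z+q^{-1/2}z^{-1}}2$, $\check x:=\frac{q^{-1/2}z+q^{1/2}z^{-1}}2$. Then $(\mathcal{D}_qf)(x):=\frac{f(\hat x)-f(\check x)}{\hat x-\check x}$ for $x\neq\pm1$ (independent of the choice of $z$), and $(\mathcal{D}_qf)(\pm1):=\lim_{x\to\pm1}(\mathcal{D}_qf)(x)=f'\left(\pm\frac{q^{1/2}+q^{-1/2}}2\right)$. It maps entire functions to entire functions; $\mathcal{D}_q^k$ is its $k$-th iterate. For an entire function $f$, $M(r;f):=\max\{|f(x)|:|x|=r\}$, and its log-order is $\sigma_{\log}(f):=\limsup_{r\to\infty}\frac{\ln^+\ln^+ M(r;f)}{\ln\ln r}\in[0,+\infty]$, where $\ln^+ t:=\max\{\ln t,0\}$. *)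

(* Defs.v *)
From HB Require Import structures.
From mathcomp Require Import all_boot all_order all_algebra.
From mathcomp Require Import complex.
From mathcomp Require Import all_classical all_reals all_analysis.
From mathcomp Require Import ring.

Set Implicit Arguments.
Unset Strict Implicit.
Unset Printing Implicit Defensive.

Import Order.TTheory GRing.Theory Num.Theory.
Import numFieldNormedType.Exports.
Import ComplexField.Normc.

Local Open Scope classical_set_scope.
Local Open Scope complex_scope.
Local Open Scope ring_scope.

Section AskeyWilson.
Variables (R : realType) (q : R).
Implicit Types (f : R[i] -> R[i]) (x z : R[i]).

(* The regular module [R[i]^o] carries the topology of the complex plane, so
   the derivatives below are complex derivatives. *)
Definition cderivable f x : Prop := @derivable R[i] R[i]^o R[i]^o f x 1.

Definition cderive f x : R[i] := @derive R[i] R[i]^o R[i]^o f x 1.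

Definition entire f : Prop := forall x, cderivable f x.

Definition transcendental_entire f : Prop :=
  entire f /\ ~ (exists p : {poly R[i]}, forall x, f x = p.[x]).

Definition joukowski z : R[i] := (z + z^-1) / 2.

(* One of the two solutions [z] of [joukowski z = x]; the other is [z^-1]. *)
Definition joukowski_inv x : R[i] := x + sqrtC (x ^+ 2 - 1).

Definition qhalf : R[i] := (Num.sqrt q)%:C.

Definition AW_quotient f z : R[i] :=
  (f (joukowski (qhalf * z)) - f (joukowski (qhalf^-1 * z))) /
  (joukowski (qhalf * z) - joukowski (qhalf^-1 * z)).

Definition Dq f x : R[i] :=
  if x == 1 then cderive f (joukowski qhalf)
  else if x == - 1 then cderive f (- joukowski qhalf)
  else AW_quotient f (joukowski_inv x).

Lemma joukowski_inv_neq0 x : joukowski_inv x != 0.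
Proof.
apply/eqP => h; have e : sqrtC (x ^+ 2 - 1) = - x.
  by apply/eqP; rewrite -addr_eq0 addrC; apply/eqP.
have := sqrtCK (x ^+ 2 - 1); rewrite e sqrrN => /esym/eqP.
by rewrite -subr_eq0 addrAC subrr add0r oppr_eq0 oner_eq0.
Qed.

Lemma joukowski_invK x : joukowski (joukowski_inv x) = x.
Proof.
have z0 := joukowski_inv_neq0 x.
have s2 := sqrtCK (x ^+ 2 - 1).
have -> : joukowski (joukowski_inv x) =
    (joukowski_inv x ^+ 2 + 1) / joukowski_inv x / 2.
  by rewrite /joukowski; field.
have -> : joukowski_inv x ^+ 2 + 1 = 2 * x * joukowski_inv x.
  by rewrite /joukowski_inv sqrrD s2; ring.
by field.
Qed.

Lemma joukowskiV z : joukowski z^-1 = joukowski z.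
Proof. by rewrite /joukowski invrK addrC. Qed.

Lemma AW_quotientV f z : AW_quotient f z^-1 = AW_quotient f z.
Proof.
have e1 : joukowski (qhalf * z^-1) = joukowski (qhalf^-1 * z).
  by rewrite -joukowskiV invfM invrK.
have e2 : joukowski (qhalf^-1 * z^-1) = joukowski (qhalf * z).
  by rewrite -joukowskiV invfM !invrK.
rewrite /AW_quotient e1 e2 -[X in X / _]opprB.
by rewrite -[X in _ / X]opprB invrN mulrNN.
Qed.

Lemma joukowski_eq z w : z != 0 -> w != 0 ->
  joukowski z = joukowski w -> z = w \/ z = w^-1.
Proof.
move=> z0 w0 /eqP; rewrite -subr_eq0.
have -> : joukowski z - joukowski w = (z - w) * (z - w^-1) / (2 * z).
  by rewrite /joukowski; field; rewrite z0 w0.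
rewrite !mulf_eq0 invr_eq0 mulf_eq0 (negPf z0) pnatr_eq0 !orbF.
by rewrite !subr_eq0 => /orP[] /eqP; [left|right].
Qed.

Lemma DqE f x z : z != 0 -> x = (z + z^-1) / 2 -> x != 1 -> x != -1 ->
  Dq f x = AW_quotient f z.
Proof.
move=> z0 xz x1 xN1; rewrite /Dq (negPf x1) (negPf xN1).
have [->|->] // := joukowski_eq (joukowski_inv_neq0 x) z0
  (etrans (joukowski_invK x) xz).
exact: AW_quotientV.
Qed.

End AskeyWilson.

Section LogOrder.
Variable R : realType.

Definition lnp (t : R) : R := Num.max (ln t) 0.

Definition maxmod (f : R[i] -> R[i]) (r : R) : R :=
  sup [set normc (f x) | x in [set x : R[i] | normc x = r]].

Definition log_order (f : R[i] -> R[i]) : \bar R :=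
  limf_esup (fun r : R => (lnp (lnp (maxmod f r)) / ln (ln r))%:E) +oo%R.

End LogOrder.

(* Main.v *)
Require Import Defs.
From HB Require Import structures.
From mathcomp Require Import all_boot all_order all_algebra.
From mathcomp Require Import complex.
From mathcomp Require Import all_classical all_reals all_analysis.
From mathcomp Require Import ring lra zify.

Set Implicit Arguments.
Unset Strict Implicit.
Unset Printing Implicit Defensive.

Import Order.TTheory GRing.Theory Num.Theory.
Import numFieldNormedType.Exports.
Import ComplexField.Normc.

Local Open Scope classical_set_scope.
Local Open Scope complex_scope.
Local Open Scope ring_scope.

(** Let [v] be the square root of [q] and [lam = ln v], and substitute
    [x = cosh w], so that the solution becomes [G w = y (cosh w)], an even entire
    function of period [2 pi i]. In this variable the Askey-Wilson operator only
    involves the shifts [w + lam] and [w - lam], and clearing denominators turns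
    the equation of order [n] into a q-difference equation
      [\sum_j B_j (exp w) * G (w + (j - n) * lam) = 0], [j] from [0] to [2 n],
    with polynomial coefficients. It is not trivial: the extreme shift [n * lam]
    is produced by the term of order [n] alone ([qdifference_equation]).

    Let [c_k] be the [k]-th Fourier coefficient of [G] with respect to [exp w],
    computed on any vertical line; it does not depend on the line, by Goursat's
    lemma on a rectangle of height [2 pi] ([rect_int_hol],
    [cint_vertical_shift]). Integrating the q-difference equation gives a linear
    recurrence between finitely many consecutive [c_k], with coefficients that
    are polynomials in [v ^+ k] ([coef_recurrence]). Such coefficients are either
    identically zero or bounded below by a geometric sequence in [k]. Hence a
    nonzero [c_s], with [s] large, forces [c_m] to be at least a constant times
    [B ^- (m ^ 2)], for a fixed [B] and infinitely many [m]
    ([recurrence_vanish]).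

    If the log-order is less than [2], then [y x] is at most
    [exp (eta * (ln |x|) ^ 2)] for every [eta > 0] and [x] large
    ([log_order_lt2_growth]), and Cauchy's estimate on the line of abscissa [T * m]
    shows that [c_m] decays faster than [D ^- (m ^ 2)] for every [D]
    ([coef_decay]). So [c_k = 0] for large [k]. As [G] is even, subtracting a
    Chebyshev sum from it leaves a function all of whose Fourier coefficients
    vanish on every vertical line. That function is zero, by an argument with the
    Fejer kernel ([fourier_uniqueness]), and [y] is a polynomial
    ([finite_coef_polynomial]). *)

(** * The modulus of a complex number *)
Section ComplexNorm.
Variable R : realType.
Local Notation C := R[i].
Implicit Types x y : C.

Lemma norm_normc x : `|x| = (normc x)%:C.
Proof. by []. Qed.

Lemma normc_ge0 x : 0 <= normc x.
Proof. by case: x => a b; exact: sqrtr_ge0. Qed.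

Lemma normcD_le x y : normc (x + y) <= normc x + normc y.
Proof. exact: le_normcD. Qed.

Lemma normc_opp x : normc (- x) = normc x.
Proof. exact: normcN. Qed.

Lemma normcB x y : normc (x - y) = normc (y - x).
Proof. by rewrite -[in LHS]opprB normc_opp. Qed.

Lemma normcB_le x y : normc (x - y) <= normc x + normc y.
Proof. by rewrite -(normc_opp y) normcD_le. Qed.

Lemma normc_real (r : R) : normc r%:C = `|r|.
Proof. by rewrite /normc /= expr0n /= addr0 sqrtr_sqr. Qed.

Lemma normc_i : normc 'i%C = 1 :> R.
Proof. by rewrite /normc /= expr0n /= add0r expr1n sqrtr1. Qed.

Lemma normcX x n : normc (x ^+ n) = normc x ^+ n.
Proof.
elim: n => [|n IH]; first by rewrite !expr0 normc1.
by rewrite !exprS normcM IH.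
Qed.

Lemma normc_eq0 x : (normc x == 0) = (x == 0).
Proof.
by apply/eqP/eqP => [/eq0_normc //|->]; rewrite normc0.
Qed.

Lemma normc_gt0 x : (0 < normc x) = (x != 0).
Proof. by rewrite lt_neqAle normc_ge0 andbT eq_sym normc_eq0. Qed.

Lemma normc_sum (I : Type) (s : seq I) (P : pred I) (F : I -> C) :
  normc (\sum_(i <- s | P i) F i) <= \sum_(i <- s | P i) normc (F i).
Proof.
elim/big_rec2: _ => [|i u v _ le]; first by rewrite normc0.
by rewrite (le_trans (normcD_le _ _)) // lerD2l.
Qed.

Lemma Re_le_normc x : `|complex.Re x| <= normc x.
Proof.
case: x => a b; rewrite /= -sqrtr_sqr ler_wsqrtr // lerDl sqr_ge0 //.
Qed.

Lemma Im_le_normc x : `|complex.Im x| <= normc x.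
Proof.
case: x => a b; rewrite /= -sqrtr_sqr ler_wsqrtr // lerDr sqr_ge0 //.
Qed.

Lemma normc_le_ReIm x :
  normc x <= `|complex.Re x| + `|complex.Im x|.
Proof.
rewrite {1}[x]complexE (le_trans (normcD_le _ _)) // normcM normc_i mul1r.
by rewrite !normc_real.
Qed.

End ComplexNorm.

(** * Integrals of complex functions along a segment *)
Section ComplexIntegral.
Variable R : realType.
Local Notation C := R[i].
Local Notation mu := (@lebesgue_measure R).
Implicit Types (g h : R -> C) (a b t : R).

Definition ccontinuous g :=
  continuous (fun t => complex.Re (g t)) /\
  continuous (fun t => complex.Im (g t)).

Definition cint a b g : C :=
  (\int[mu]_(t in `[a, b]) complex.Re (g t)) +i*
  (\int[mu]_(t in `[a, b]) complex.Im (g t)).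

Lemma ccontinuousP g :
  (forall t e, 0 < e -> exists2 d, 0 < d &
     forall u, `|u - t| < d -> normc (g u - g t) < e) -> ccontinuous g.
Proof.
move=> H; split=> t; apply/cvgrPdist_lt => e e0; have [d d0 Hd] := H t e e0;
  near=> u.
  rewrite distrC; apply: le_lt_trans (Hd u _).
    by have := Re_le_normc (g u - g t); case: (g u); case: (g t).
  rewrite distrC; near: u; exact: cvgr_dist_lt.
rewrite distrC; apply: le_lt_trans (Hd u _).
  by have := Im_le_normc (g u - g t); case: (g u); case: (g t).
rewrite distrC; near: u; exact: cvgr_dist_lt.
Unshelve. all: by end_near. Qed.

Lemma ccontinuous_cst (c : C) : ccontinuous (fun=> c).
Proof. by split=> t; exact: cvg_cst. Qed.

Lemma ccontinuousD g h : ccontinuous g -> ccontinuous h ->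
  ccontinuous (fun t => g t + h t).
Proof.
move=> [g1 g2] [h1 h2]; split=> t.
  rewrite (_ : (fun _ => _) =
      (fun t => complex.Re (g t)) \+ (fun t => complex.Re (h t))).
    by apply: cvgD; [exact: g1|exact: h1].
  by apply/funext => u /=; case: (g u); case: (h u).
rewrite (_ : (fun _ => _) =
    (fun t => complex.Im (g t)) \+ (fun t => complex.Im (h t))).
  by apply: cvgD; [exact: g2|exact: h2].
by apply/funext => u /=; case: (g u); case: (h u).
Qed.

Lemma ccontinuousM g h : ccontinuous g -> ccontinuous h ->
  ccontinuous (fun t => g t * h t).
Proof.
move=> [g1 g2] [h1 h2]; split=> t.
  rewrite (_ : (fun _ => _) = (fun t => complex.Re (g t) * complex.Re (h t)
      - complex.Im (g t) * complex.Im (h t))).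
    by apply: cvgB; apply: cvgM; [exact: g1|exact: h1|exact: g2|exact: h2].
  by apply/funext => u /=; case: (g u); case: (h u).
rewrite (_ : (fun _ => _) = (fun t => complex.Re (g t) * complex.Im (h t)
    + complex.Im (g t) * complex.Re (h t))).
  by apply: cvgD; apply: cvgM; [exact: g1|exact: h2|exact: g2|exact: h1].
by apply/funext => u /=; case: (g u); case: (h u).
Qed.

Lemma ccontinuous_sum (I : Type) (s : seq I) (F : I -> R -> C) :
  (forall i, ccontinuous (F i)) -> ccontinuous (fun t => \sum_(i <- s) F i t).
Proof.
move=> H; elim: s => [|i s IH].
  rewrite (_ : (fun _ => _) = fun=> 0); first exact: ccontinuous_cst.
  by apply/funext => t; rewrite big_nil.
rewrite (_ : (fun _ => _) = (fun t => F i t + \sum_(j <- s) F j t)).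
  exact: ccontinuousD.
by apply/funext => t; rewrite big_cons.
Qed.

Lemma continuous_integrable (f : R -> R) a b : continuous f ->
  mu.-integrable `[a, b] (EFin \o f).
Proof.
move=> cf; apply: continuous_compact_integrable; first exact: segment_compact.
exact: continuous_subspaceT.
Qed.

Lemma cint_cst a b (c : C) : a <= b -> cint a b (fun=> c) = (b - a)%:C * c.
Proof.
move=> ab; rewrite /cint !Rintegral_cst //= lebesgue_measure_itv /=.
have -> : fine (if (a%:E < b%:E)%E then (b%:E - a%:E)%E else 0%E) = b - a.
  rewrite lte_fin; case: ltP => // ba.
  by rewrite (@le_anti _ _ a b) ?subrr // ab.
by case: c => x y /=; simpc; rewrite mulrC [y * _]mulrC.
Qed.

Lemma cintD a b g h : ccontinuous g -> ccontinuous h ->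
  cint a b (fun t => g t + h t) = cint a b g + cint a b h.
Proof.
move=> [g1 g2] [h1 h2]; rewrite /cint; simpc; congr (_ +i* _).
  rewrite -RintegralD //; try exact: continuous_integrable.
  by apply: eq_Rintegral => t _; case: (g t); case: (h t).
rewrite -RintegralD //; try exact: continuous_integrable.
by apply: eq_Rintegral => t _; case: (g t); case: (h t).
Qed.

Lemma cintZ a b (c : C) g : ccontinuous g ->
  cint a b (fun t => c * g t) = c * cint a b g.
Proof.
case: c => x y [g1 g2]; rewrite /cint; simpc.
rewrite -!RintegralZl //; try exact: continuous_integrable.
rewrite -RintegralB // -?RintegralD //;
  try by apply: continuous_integrable => t; apply: cvgM; first exact: cvg_cst;
     first [exact: g1|exact: g2].
congr (_ +i* _); apply: eq_Rintegral => t _; case: (g t) => u v //=.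
Qed.

Lemma cint_sum a b (I : Type) (s : seq I) (F : I -> R -> C) :
  (forall i, ccontinuous (F i)) ->
  cint a b (fun t => \sum_(i <- s) F i t) = \sum_(i <- s) cint a b (F i).
Proof.
move=> H; elim: s => [|i s IH].
  rewrite big_nil -[RHS](mul0r (cint a b (fun=> 0))) -cintZ.
    by congr cint; apply/funext => t; rewrite big_nil mul0r.
  exact: ccontinuous_cst.
rewrite big_cons -IH -cintD //; last exact: ccontinuous_sum.
by congr cint; apply/funext => t; rewrite big_cons.
Qed.

Lemma Rintegral_split (f : R -> R) a m b : continuous f -> a <= m -> m <= b ->
  \int[mu]_(t in `[a, b]) f t =
  \int[mu]_(t in `[a, m]) f t + \int[mu]_(t in `[m, b]) f t.
Proof.
move=> cf am mb; rewrite -(Rintegral_itv_obnd_cbnd (r := m)).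
  rewrite -(@Rintegral_itvB _ f (BLeft a) (BRight b) m) ?bnd_simp //.
    by rewrite addrC subrK.
  exact: continuous_integrable.
apply: integrableS (continuous_integrable m b cf) => //.
exact: subset_itv_oc_cc.
Qed.

Lemma cint_split a m b g : ccontinuous g -> a <= m -> m <= b ->
  cint a b g = cint a m g + cint m b g.
Proof.
move=> [g1 g2] am mb; rewrite /cint; simpc.
by congr (_ +i* _); exact: Rintegral_split.
Qed.

Lemma cint_oppr a b g : ccontinuous g -> a <= b ->
  cint (- b) (- a) g = cint a b (fun t => g (- t)).
Proof.
move=> [g1 g2] ab; rewrite /cint; congr (_ +i* _); rewrite /Rintegral.
  rewrite integration_by_substitution_oppr //.
  exact: (continuous_subspaceT g1).
rewrite integration_by_substitution_oppr //.
exact: (continuous_subspaceT g2).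
Qed.

(** The factor [2] comes from bounding the real and imaginary parts
    separately. *)
Lemma normc_cint_le a b g (B : R -> R) : ccontinuous g -> continuous B ->
  (forall t, a <= t <= b -> normc (g t) <= B t) ->
  normc (cint a b g) <= 2 * \int[mu]_(t in `[a, b]) B t.
Proof.
move=> [g1 g2] cB gB; rewrite (le_trans (normc_le_ReIm _)) //.
rewrite mulr_natl mulr2n; apply: lerD.
  rewrite (le_trans (le_normr_Rintegral _ _)) //; first exact: continuous_integrable.
  apply: le_Rintegral => //; last first.
  - by move=> t /= ; rewrite in_itv /= => /gB; apply: le_trans; exact: Re_le_normc.
  - exact: continuous_integrable.
  - apply: (continuous_integrable (f := fun t => `|complex.Re (g t)|)) => t.
    by apply: cvg_norm; exact: g1.
rewrite (le_trans (le_normr_Rintegral _ _)) //; first exact: continuous_integrable.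
apply: le_Rintegral => //; last first.
- by move=> t /= ; rewrite in_itv /= => /gB; apply: le_trans; exact: Im_le_normc.
- exact: continuous_integrable.
- apply: (continuous_integrable (f := fun t => `|complex.Im (g t)|)) => t.
  by apply: cvg_norm; exact: g2.
Qed.

Lemma Rint_cst a b (c : R) : a <= b ->
  \int[mu]_(t in `[a, b]) c = (b - a) * c.
Proof.
move=> ab; have := cint_cst c%:C ab; rewrite /cint; simpc.
by case.
Qed.

Lemma normc_cint_le_cst a b g (B : R) : a <= b -> ccontinuous g ->
  (forall t, a <= t <= b -> normc (g t) <= B) ->
  normc (cint a b g) <= 2 * ((b - a) * B).
Proof.
move=> ab cg gB; rewrite -(Rint_cst _ ab).
by apply: normc_cint_le => // t; exact: cvg_cst.
Qed.

End ComplexIntegral.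
(** * The complex exponential and complex differentiability *)

(** Locked, because unification otherwise unfolds it into a product of a real
    and a complex factor. *)
HB.lock Definition expc (R : realType) (w : R[i]) : R[i] :=
  (expR (complex.Re w))%:C * (cos (complex.Im w) +i* sin (complex.Im w)).

Arguments expc {R} w.

Section Holomorphic.
Variable R : realType.
Local Notation C := R[i].
Implicit Types (f g : C -> C) (x w z : C).

Definition hol f := forall x : C^o, differentiable (f : C^o -> C^o) x.

Lemma derivable_epsP f x :
  @derivable C C^o C^o f x 1 <->
  exists D, forall e : R, 0 < e -> exists2 d : R, 0 < d &
    forall h, normc h < d -> normc (f (x + h) - f x - D * h) <= e * normc h.
Proof.
split.
  move=> /cvg_ex [D /cvgrPdist_lt H]; exists D => e e0.
  have /H : 0 < e%:C by rewrite ltcR.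
  move=> /nbhs_ballP[d /= d0 Hd].
  have dR : d = (complex.Re d)%:C by rewrite RRe_real // gtr0_real.
  exists (complex.Re d); first by rewrite -ltcR -dR.
  move=> h hd; have [->|h0] := eqVneq h 0.
    by rewrite addr0 subrr mulr0 subr0 normc0 mulr0.
  have hb : ball_ [eta @Num.norm C C] 0 d h.
    by rewrite /ball_ /= sub0r normrN dR norm_normc ltcR.
  have := Hd h hb h0; rewrite norm_normc ltcR => /ltW le.
  have -> : f (x + h) - f x - D * h =
      - ((D - h^-1 *: (f (h *: 1 + x) - f x)) * h).
    rewrite /GRing.scale /= mulr1 [h + x]addrC; field.
    by rewrite h0.
  by rewrite normc_opp normcM ler_wpM2r // normc_ge0.
move=> [D H]; apply/cvg_ex; exists D; apply/cvgrPdist_le => e e0.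
have eR : e = (complex.Re e)%:C by rewrite RRe_real // gtr0_real.
have [|d d0 Hd] := H (complex.Re e); first by rewrite -ltcR -eR.
apply/nbhs_ballP; exists d%:C; first by rewrite /= ltcR.
move=> h; rewrite /ball /= sub0r normrN norm_normc ltcR => hd h0.
rewrite eR norm_normc lecR.
have -> : D - h^-1 *: (f (h *: 1 + x) - f x) =
    - ((f (x + h) - f x - D * h) / h).
  rewrite /GRing.scale /= mulr1 [h + x]addrC; field.
  by rewrite h0.
rewrite normc_opp normcM normcV ler_pdivrMr ?normc_gt0 //.
exact: Hd.
Qed.

Lemma hol_epsP f : hol f <-> forall x, exists D, forall e : R, 0 < e ->
  exists2 d : R, 0 < d &
    forall h, normc h < d -> normc (f (x + h) - f x - D * h) <= e * normc h.
Proof.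
split=> H x; first by apply/derivable_epsP/derivable1_diffP; exact: H.
by apply/derivable1_diffP/derivable_epsP; exact: H.
Qed.

Lemma entire_hol f : entire f -> hol f.
Proof. by move=> H x; apply/derivable1_diffP; exact: H. Qed.

Lemma hol_cst (c : C) : hol (fun=> c).
Proof. by move=> x; exact: differentiable_cst. Qed.

Lemma hol_id : hol id.
Proof. by move=> x; apply/derivable1_diffP; exact: derivable_id. Qed.

Lemma holD f g : hol f -> hol g -> hol (fun x => f x + g x).
Proof. by move=> hf hg x; exact: (differentiableD (hf x) (hg x)). Qed.

Lemma holM f g : hol f -> hol g -> hol (fun x => f x * g x).
Proof. by move=> hf hg x; exact: (differentiableM (hf x) (hg x)). Qed.

Lemma holX f n : hol f -> hol (fun x => f x ^+ n).
Proof.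
move=> hf; elim: n => [|n IH].
  by rewrite (_ : (fun _ => _) = fun=> 1); [exact: hol_cst|apply/funext => x].
rewrite (_ : (fun _ => _) = fun x => f x * f x ^+ n); first exact: holM.
by apply/funext => x; rewrite exprS.
Qed.

Lemma hol_comp f g : hol f -> hol g -> hol (fun x => g (f x)).
Proof. by move=> hf hg x; exact: (differentiable_comp (hf x) (hg (f x))). Qed.

Lemma hol_sum (I : Type) (s : seq I) (F : I -> C -> C) :
  (forall i, hol (F i)) -> hol (fun x => \sum_(i <- s) F i x).
Proof.
move=> H; elim: s => [|i s IH].
  by rewrite (_ : (fun _ => _) = fun=> 0); [exact: hol_cst
    |apply/funext => x; rewrite big_nil].
rewrite (_ : (fun _ => _) = fun x => F i x + \sum_(j <- s) F j x).
  exact: holD.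
by apply/funext => x; rewrite big_cons.
Qed.

Lemma hol_lipschitz f x : hol f ->
  exists2 L : R, 0 <= L & exists2 d : R, 0 < d &
    forall h, normc h < d -> normc (f (x + h) - f x) <= L * normc h.
Proof.
move=> /hol_epsP /(_ x) [D /(_ 1 ltr01) [d d0 H]].
exists (1 + normc D); first by rewrite addr_ge0 // normc_ge0.
exists d => // h hd; rewrite mulrDl -normcM.
rewrite -[f (x + h) - f x](subrK (D * h)) (le_trans (normcD_le _ _)) //.
by rewrite lerD2r H.
Qed.

Lemma hol_ccontinuous f (p v : C) : hol f ->
  ccontinuous (fun t : R => f (p + v * t%:C)).
Proof.
move=> hf; apply: ccontinuousP => t e e0.
have [L L0 [d d0 H]] := hol_lipschitz (p + v * t%:C) hf.
have m0 : 0 < normc v + 1 by rewrite ltr_wpDl ?normc_ge0.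
have L10 : 0 < L + 1 by rewrite ltr_wpDl.
exists (Num.min d (e / (L + 1)) / (normc v + 1)).
  by rewrite divr_gt0 // lt_min d0 divr_gt0.
move=> u; rewrite ltr_pdivlMr // => hu.
have E : normc (v * (u - t)%:C) < Num.min d (e / (L + 1)).
  rewrite normcM normc_real mulrC; apply: le_lt_trans hu.
  by rewrite ler_wpM2l // lerDl.
move: E; rewrite lt_min => /andP[E1 E2].
have -> : p + v * u%:C = p + v * t%:C + v * (u - t)%:C.
  by rewrite -addrA -mulrDr -rmorphD /= [t + _]addrC subrK.
apply: le_lt_trans (H _ E1) _.
rewrite ltr_pdivlMr // mulrC in E2; apply: le_lt_trans E2.
by rewrite ler_wpM2r ?normc_ge0 // lerDl.
Qed.

Lemma expc0 : expc (0 : C) = 1.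
Proof. by rewrite !expc.unlock /= expR0 cos0 sin0 mul1r. Qed.

Lemma expcD w z : expc (w + z) = expc w * expc z.
Proof.
case: w z => [a b] [c d]; rewrite !expc.unlock /= expRD sinD cosD; simpc.
congr (_ +i* _); ring.
Qed.

Lemma expc_neq0 w : expc w != 0.
Proof.
apply/eqP => e; have := expcD w (- w); rewrite subrr expc0 e mul0r.
by move=> /eqP; rewrite oner_eq0.
Qed.

Lemma expcN w : expc (- w) = (expc w)^-1.
Proof.
apply: (mulIf (expc_neq0 w)).
by rewrite -expcD addNr expc0 mulVf // expc_neq0.
Qed.

Lemma normc_expc w : normc (expc w) = expR (complex.Re w).
Proof.
rewrite !expc.unlock normcM normc_real /= cos2Dsin2 sqrtr1 mulr1.
by rewrite gtr0_norm // expR_gt0.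
Qed.

Lemma expc_real (s : R) : expc s%:C = (expR s)%:C.
Proof. by rewrite !expc.unlock /= cos0 sin0; simpc. Qed.

Lemma expc_i (t : R) : expc ('i%C * t%:C) = cos t +i* sin t.
Proof. by rewrite !expc.unlock /=; simpc; rewrite expR0; simpc. Qed.

Lemma is_derive_eps (f : R -> R) (x l : R) : is_derive x 1 f l ->
  forall e : R, 0 < e -> exists2 d : R, 0 < d &
    forall h, `|h| < d -> `|f (x + h) - f x - l * h| <= e * `|h|.
Proof.
move=> [/cvg_ex [D HD] Hl] e e0.
have {Hl} Dl : D = l by rewrite -Hl; apply/esym; apply: cvg_lim.
move: HD; rewrite Dl => /cvgrPdist_lt /(_ e e0).
move=> /nbhs_ballP[d /= d0 Hd].
exists d => // h hd; have [->|h0] := eqVneq h 0.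
  by rewrite addr0 subrr mulr0 subr0 normr0 mulr0.
have := Hd h _ h0; rewrite /ball /= sub0r normrN => /(_ hd) /ltW le.
have -> : f (x + h) - f x - l * h =
    - ((l - h^-1 *: (f (h *: 1 + x) - f x)) * h).
  rewrite /GRing.scale /= mulr1 [h + x]addrC; field.
  by rewrite h0.
by rewrite normrN normrM ler_wpM2r.
Qed.

Lemma hol_expc : hol (@expc R).
Proof.
apply/hol_epsP => x; exists (expc x) => e e0.
have ex0 : 0 < normc (expc x) by rewrite normc_gt0 expc_neq0.
(* The error splits into three terms, at most [4 e'], [e'] and [e'] times the
   modulus of the increment. *)
pose e' := e / normc (expc x) / 6.
have e'0 : 0 < e' by rewrite !divr_gt0.
have [d1 d10 H1] := is_derive_eps (is_derive_expR 0) e'0.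
have [d2 d20 H2] := is_derive_eps (is_derive_cos 0) e'0.
have [d3 d30 H3] := is_derive_eps (is_derive_sin 0) e'0.
pose m := Num.min 1 e'; have m0 : 0 < m by rewrite lt_min ltr01.
exists (Num.min (Num.min d1 (m / (1 + e'))) (Num.min d2 d3)).
  by rewrite !lt_min d10 d20 d30 divr_gt0 // ltr_wpDl.
move=> [a b]; set h := a +i* b; rewrite !lt_min.
move=> /andP[/andP[h1 hm] /andP[h2 h3]].
have ha : `|a| <= normc h := Re_le_normc h.
have hb : `|b| <= normc h := Im_le_normc h.
have {H1} := H1 a (le_lt_trans ha h1); rewrite add0r expR0 mul1r => H1.
have {H2} := H2 b (le_lt_trans hb h2); rewrite add0r cos0 sin0 oppr0 mul0r subr0 => H2.
have {H3} := H3 b (le_lt_trans hb h3); rewrite add0r sin0 cos0 subr0 mul1r => H3.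
have Ea : `|expR a - 1| <= m.
  rewrite -[expR a - 1](subrK a) (le_trans (ler_normD _ _)) //.
  rewrite ltr_pdivlMr ?ltr_wpDl // in hm; apply: le_trans (ltW hm).
  rewrite mulrDr mulr1 addrC; apply: lerD => //.
  by rewrite (le_trans H1) // mulrC ler_wpM2r // ltW.
have Ea2 : `|expR a| <= 2.
  rewrite -[expR a](subrK 1) (le_trans (ler_normD _ _)) // normr1.
  have -> : 2 = 1 + 1 :> R by rewrite -natr1.
  by rewrite lerD2r (le_trans Ea) // ge_min lexx.
have -> : expc (x + h) - expc x - expc x * h = expc x *
    ((expR a)%:C * ((cos b - 1)%:C + 'i%C * (sin b - b)%:C)
     + (expR a - 1 - a)%:C + 'i%C * b%:C * (expR a - 1)%:C).
  rewrite expcD !expc.unlock /= -[X in X = _]addrA -opprD -[X in _ * _ - (X + _)]mulr1.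
  rewrite -mulrDr -mulrBr; congr (_ * _); rewrite /h; simpc.
  congr (_ +i* _); ring.
rewrite normcM.
have -> : e * normc h = normc (expc x) * (6 * (e' * normc h)).
  by rewrite /e'; field; rewrite gt_eqF.
rewrite ler_pM2l //.
have T1 : normc ((expR a)%:C * ((cos b - 1)%:C + 'i%C * (sin b - b)%:C)) <=
    2 * (2 * (e' * normc h)).
  rewrite normcM normc_real ler_pM // ?normc_ge0 //.
  rewrite (le_trans (normcD_le _ _)) // normcM normc_i mul1r !normc_real.
  rewrite mulr_natl mulr2n; apply: lerD.
    by rewrite (le_trans H2) // ler_wpM2l // ltW.
  by rewrite (le_trans H3) // ler_wpM2l // ltW.
have T2 : normc (expR a - 1 - a)%:C <= e' * normc h.
  by rewrite normc_real (le_trans H1) // ler_wpM2l // ltW.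
have T3 : normc ('i%C * b%:C * (expR a - 1)%:C) <= e' * normc h.
  rewrite !normcM normc_i mul1r !normc_real mulrC ler_pM //.
  by rewrite (le_trans Ea) // ge_min lexx orbT.
rewrite (le_trans (normcD_le _ _)) // (le_trans (lerD (normcD_le _ _) (lexx _))) //.
rewrite (le_trans (lerD (lerD T1 T2) T3)) //.
by rewrite le_eqVlt; apply/orP; left; apply/eqP; ring.
Qed.

End Holomorphic.
(** * Goursat's lemma on rectangles *)
Section Goursat.
Variable R : realType.
Local Notation C := R[i].
Implicit Types (G : C -> C) (a b c d : R).

Definition rect_int G a b c d : C :=
  cint a b (fun t => G ('i%C * c%:C + 1 * t%:C)) -
  cint a b (fun t => G ('i%C * d%:C + 1 * t%:C)) +
  'i%C * (cint c d (fun t => G (b%:C + 'i%C * t%:C)) -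
        cint c d (fun t => G (a%:C + 'i%C * t%:C))).

Lemma rect_int_hsplit G a m b c d : hol G -> a <= m -> m <= b ->
  rect_int G a b c d = rect_int G a m c d + rect_int G m b c d.
Proof.
move=> hG am mb; rewrite /rect_int.
rewrite !(cint_split (hol_ccontinuous _ _ hG) am mb); ring.
Qed.

Lemma rect_int_vsplit G a b c m d : hol G -> c <= m -> m <= d ->
  rect_int G a b c d = rect_int G a b c m + rect_int G a b m d.
Proof.
move=> hG cm md; rewrite /rect_int.
rewrite !(cint_split (hol_ccontinuous _ _ hG) cm md); ring.
Qed.

Lemma rect_intD F G a b c d : hol F -> hol G ->
  rect_int (fun w => F w + G w) a b c d =
  rect_int F a b c d + rect_int G a b c d.
Proof.
move=> hF hG; rewrite /rect_int.
rewrite !(cintD _ _ (hol_ccontinuous _ _ hF) (hol_ccontinuous _ _ hG)); ring.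
Qed.

Lemma rect_int_affine (A B : C) a b c d : a <= b -> c <= d ->
  rect_int (fun w => A + B * w) a b c d = 0.
Proof.
move=> ab cd; rewrite /rect_int.
have hB : hol (fun w : C => B * w) by apply: holM (@hol_cst _ _) (@hol_id _).
have cB p v := hol_ccontinuous p v hB.
have cA := @ccontinuous_cst R A.
rewrite !(cintD _ _ cA (cB _ _)).
have lin p v u w : u <= w -> cint u w (fun t => B * (p + v * t%:C)) =
    (w - u)%:C * (B * p) + cint u w (fun t => B * (v * t%:C)).
  move=> uw; rewrite -(cint_cst _ uw) -cintD; first last.
  - have := cB 0 v; rewrite (_ : (fun _ => _) = fun t => B * (v * t%:C)) //.
    by apply/funext => t; rewrite add0r.
  - exact: ccontinuous_cst.
  by congr cint; apply/funext => t; rewrite mulrDr.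
rewrite !lin // !cint_cst // !rmorphB /=.
ring.
Qed.

(** Near [(x0, y0)] the function is affine up to an error [e] times the
    half-perimeter of the rectangle, and the affine part integrates to zero. *)
Lemma rect_int_local G (x0 y0 : R) (e : R) : hol G -> 0 < e ->
  exists2 r : R, 0 < r & forall a b c d,
    a <= x0 <= b -> c <= y0 <= d -> (b - a) + (d - c) < r ->
    normc (rect_int G a b c d) <= 4 * e * ((b - a) + (d - c)) ^+ 2.
Proof.
move=> hG e0; pose p : C := x0 +i* y0.
have /hol_epsP /(_ p) [D /(_ e e0) [r r0 H]] := hG.
exists r => // a b c d /andP[ax xb] /andP[cy yd] lr; set l := _ + _ in lr *.
have ab : a <= b by exact: le_trans xb.
have cd : c <= d by exact: le_trans yd.
pose aff w := (G p - D * p) + D * w.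
pose rho w := G w + ((D * p - G p) + (- D) * w).
have haff : hol aff.
  by apply: holD (@hol_cst _ _) (holM (@hol_cst _ _) (@hol_id _)).
have hrho : hol rho.
  apply: holD hG _.
  by apply: holD (@hol_cst _ _) (holM (@hol_cst _ _) (@hol_id _)).
have -> : rect_int G a b c d = rect_int rho a b c d.
  have -> : G = fun w => rho w + aff w.
    by apply/funext => w; rewrite /rho /aff; ring.
  by rewrite rect_intD // (rect_int_affine _ _ ab cd) addr0.
have l0 : 0 <= l by rewrite addr_ge0 // subr_ge0.
have rho_le (x y : R) : a <= x <= b -> c <= y <= d ->
    normc (rho (x +i* y)) <= e * l.
  move=> /andP[ax' xb'] /andP[cy' yd'].
  have hl : normc ((x - x0) +i* (y - y0)) <= l.
    apply: le_trans (normc_le_ReIm _) _; rewrite /l; apply: lerD => /=;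
      rewrite ler_norml opprB.
      by apply/andP; split; apply: lerB.
    by apply/andP; split; apply: lerB.
  have -> : x +i* y = p + ((x - x0) +i* (y - y0)).
    by rewrite /p; simpc; rewrite [x0 + _]addrC [y0 + _]addrC !subrK.
  set h := _ +i* _ in hl *.
  have -> : rho (p + h) = G (p + h) - G p - D * h by rewrite /rho; ring.
  apply: le_trans (H _ (le_lt_trans hl lr)) _.
  by rewrite ler_wpM2l // ltW.
have hor (y : R) : c <= y <= d ->
    normc (cint a b (fun t => rho ('i%C * y%:C + 1 * t%:C))) <= 2 * ((b - a) * (e * l)).
  move=> hy; apply: normc_cint_le_cst => // [|t ht].
    exact: hol_ccontinuous.
  have -> : 'i%C * y%:C + 1 * t%:C = t +i* y by simpc.
  exact: rho_le.
have ver (x : R) : a <= x <= b ->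
    normc (cint c d (fun t => rho (x%:C + 'i%C * t%:C))) <= 2 * ((d - c) * (e * l)).
  move=> hx; apply: normc_cint_le_cst => // [|t ht].
    exact: hol_ccontinuous.
  have -> : x%:C + 'i%C * t%:C = x +i* t by simpc.
  exact: rho_le.
rewrite /rect_int; apply: le_trans (normcD_le _ _) _.
rewrite normcM normc_i mul1r.
apply: le_trans (lerD (normcB_le _ _) (normcB_le _ _)) _.
have -> : 4 * e * l ^+ 2 = (2 * ((b - a) * (e * l)) + 2 * ((b - a) * (e * l)))
    + (2 * ((d - c) * (e * l)) + 2 * ((d - c) * (e * l))).
  by rewrite /l; ring.
apply: lerD; apply: lerD.
- by apply: hor; rewrite lexx.
- by apply: hor; rewrite lexx andbT.
- by apply: ver; rewrite lexx andbT.
- by apply: ver; rewrite lexx.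
Qed.

Lemma mid_between (x y : R) : x <= y -> x <= (x + y) / 2 /\ (x + y) / 2 <= y.
Proof. by move=> xy; split; lra. Qed.

Lemma some_of_four (x u v w z : R) : x <= u + v + (w + z) ->
  [\/ x <= 4 * u, x <= 4 * v, x <= 4 * w | x <= 4 * z].
Proof.
move=> H; have [h1|h1] := leP x (4 * u); first by constructor 1.
have [h2|h2] := leP x (4 * v); first by constructor 2.
have [h3|h3] := leP x (4 * w); first by constructor 3.
by constructor 4; lra.
Qed.

Lemma rect_int_quarter G a b c d : hol G -> a <= b -> c <= d ->
  exists r : R * R * (R * R),
    [/\ a <= r.1.1, r.1.2 <= b, r.1.2 - r.1.1 = (b - a) / 2 &
        [/\ c <= r.2.1, r.2.2 <= d, r.2.2 - r.2.1 = (d - c) / 2 &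
          normc (rect_int G a b c d) <=
            4 * normc (rect_int G r.1.1 r.1.2 r.2.1 r.2.2)]].
Proof.
move=> hG ab cd; pose m := (a + b) / 2; pose n := (c + d) / 2.
have [am mb] : a <= m /\ m <= b by by exact: mid_between.
have [cn nd] : c <= n /\ n <= d by by exact: mid_between.
have E : rect_int G a b c d = rect_int G a m c n + rect_int G a m n d +
    (rect_int G m b c n + rect_int G m b n d).
  by rewrite (rect_int_hsplit _ _ hG am mb) !(rect_int_vsplit _ _ hG cn nd).
set I := normc _.
have tri : I <= normc (rect_int G a m c n) + normc (rect_int G a m n d) +
    (normc (rect_int G m b c n) + normc (rect_int G m b n d)).
  rewrite /I E; apply: le_trans (normcD_le _ _) _.
  by apply: lerD; exact: normcD_le.
have lm : m - a = (b - a) / 2 by rewrite /m; field.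
have lm' : b - m = (b - a) / 2 by rewrite /m; field.
have ln : n - c = (d - c) / 2 by rewrite /n; field.
have ln' : d - n = (d - c) / 2 by rewrite /n; field.
case: (some_of_four tri) => H.
- by exists ((a, m), (c, n)).
- by exists ((a, m), (n, d)).
- by exists ((m, b), (c, n)).
- by exists ((m, b), (n, d)).
Qed.

Lemma nested_intervals (a b : nat -> R) :
  (forall n, a n <= a n.+1) -> (forall n, b n.+1 <= b n) ->
  (forall n, a n <= b n) -> exists x, forall n, a n <= x <= b n.
Proof.
move=> inca decb ab.
have nda : {homo a : m n / (m <= n)%N >-> m <= n} by apply: homo_leq => // ? ? ?; apply: le_trans.
have ndb : {homo b : m n / (m <= n)%N >-> n <= m}.
  by apply: (homo_leq (r := fun x y => y <= x)) => // x y z xy yz; apply: le_trans yz xy.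
have leab m n : a m <= b n.
  apply: le_trans (nda _ _ (leq_maxl m n)) _; apply: le_trans (ab _) _.
  exact: ndb (leq_maxr m n).
have hs : has_sup (range a) by split; [exists (a 0), 0%N|exists (b 0) => _ [n _ <-]].
exists (sup (range a)) => n; apply/andP; split.
  by apply: ub_le_sup; [case: hs|exists n].
by apply: ge_sup; [case: hs|move=> _ [m _ <-]].
Qed.

(** Repeated quartering shrinks to a point; there the local bound is quadratic in
    the side length, which compensates exactly the factor [4 ^+ n] lost after [n]
    steps. *)
Theorem rect_int_hol G a b c d : hol G -> a <= b -> c <= d ->
  rect_int G a b c d = 0.
Proof.
move=> hG ab cd.
pose ok (r : R * R * (R * R)) := r.1.1 <= r.1.2 /\ r.2.1 <= r.2.2.
pose I (r : R * R * (R * R)) := normc (rect_int G r.1.1 r.1.2 r.2.1 r.2.2).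
pose quarter (r r' : R * R * (R * R)) := ok r ->
    [/\ r.1.1 <= r'.1.1, r'.1.2 <= r.1.2,
        r'.1.2 - r'.1.1 = (r.1.2 - r.1.1) / 2 &
        [/\ r.2.1 <= r'.2.1, r'.2.2 <= r.2.2,
        r'.2.2 - r'.2.1 = (r.2.2 - r.2.1) / 2 &
        I r <= 4 * I r']].
have /choice[f Hf] : forall r, exists r', quarter r r'.
  move=> -[[a' b'] [c' d']].
  have [[/= h1 h2]|no] := pselect (ok ((a', b'), (c', d'))); last first.
    by exists ((a', b'), (c', d')).
  by have [r Hr] := rect_int_quarter hG h1 h2; exists r.
pose r n := iter n f ((a, b), (c, d)).
have okr n : ok (r n).
  elim: n => [//|n IH]; have [_ _ e1 [_ _ e2 _]] := Hf _ IH.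
  case: IH => i1 i2; rewrite /r iterS; split; rewrite -subr_ge0 ?e1 ?e2.
    by rewrite divr_ge0 // subr_ge0.
  by rewrite divr_ge0 // subr_ge0.
have lenr n : (r n).1.2 - (r n).1.1 = (b - a) / 2 ^+ n /\
    (r n).2.2 - (r n).2.1 = (d - c) / 2 ^+ n.
  elim: n => [|n [IH1 IH2]]; first by rewrite expr0 !divr1.
  have [_ _ e1 [_ _ e2 _]] := Hf _ (okr n); rewrite /r iterS e1 e2 IH1 IH2.
  by rewrite exprS invfM !mulrA; split; ring.
have Ir n : I (r 0%N) <= 4 ^+ n * I (r n).
  elim: n => [|n IH]; first by rewrite expr0 mul1r.
  apply: le_trans IH _; rewrite exprSr -mulrA ler_pM2l ?exprn_gt0 //.
  by have [_ _ _ [_ _ _]] := Hf _ (okr n).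
have [x0 Hx] : exists x, forall n, (r n).1.1 <= x <= (r n).1.2.
  apply: nested_intervals => n; last by case: (okr n).
    by have [] := Hf _ (okr n).
  by have [] := Hf _ (okr n).
have [y0 Hy] : exists x, forall n, (r n).2.1 <= x <= (r n).2.2.
  apply: nested_intervals => n; last by case: (okr n).
    by have [_ _ _ []] := Hf _ (okr n).
  by have [_ _ _ []] := Hf _ (okr n).
apply: eq0_normc; apply/eqP; rewrite eq_le normc_ge0 andbT.
apply/ler_addgt0Pr => e e0; rewrite add0r.
set l := (b - a) + (d - c).
have l0 : 0 <= l by rewrite addr_ge0 // subr_ge0.
have l1 : 0 < 4 * (l ^+ 2 + 1) by rewrite mulr_gt0 // ltr_wpDl // sqr_ge0.
have [rr rr0 Hr] := rect_int_local x0 y0 hG (divr_gt0 e0 l1).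
have [n ln] : exists n, l / 2 ^+ n < rr.
  have [n hn] : exists n, l / rr < n%:R.
    by exists (Num.bound (l / rr)); apply: archi_boundP; rewrite divr_ge0 // ltW.
  exists n; rewrite ltr_pdivrMr ?exprn_gt0 // mulrC -ltr_pdivrMr //.
  apply: lt_trans hn _; rewrite -natrX ltr_nat; exact: ltn_expl.
have [e1 e2] := lenr n.
have L : (r n).1.2 - (r n).1.1 + ((r n).2.2 - (r n).2.1) = l / 2 ^+ n.
  by rewrite e1 e2 -mulrDl.
have := Hr _ _ _ _ (Hx n) (Hy n); rewrite L => /(_ ln) le.
apply: le_trans (Ir n) _.
apply: le_trans (ler_wpM2l _ le) _; first by rewrite exprn_ge0.
have -> : 4 ^+ n * (4 * (e / (4 * (l ^+ 2 + 1))) * (l / 2 ^+ n) ^+ 2) =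
    e * (l ^+ 2 / (l ^+ 2 + 1)).
  have -> : (4 : R) = 2 ^+ 2 by rewrite -natrX.
  rewrite -exprM mulnC exprM; field.
  by rewrite ?expf_eq0 ?pnatr_eq0 ?andbF /= gt_eqF // ltr_wpDl // sqr_ge0.
rewrite -[leRHS]mulr1 ler_pM2l // ler_pdivrMr ?mul1r ?lerDl //.
by rewrite ltr_wpDl // sqr_ge0.
Qed.

(** By periodicity the horizontal sides of a rectangle of height [2 pi] cancel,
    so Goursat's lemma equates the vertical ones. *)
Lemma cint_vertical_shift G (s s' : R) : hol G ->
  (forall w, G (w + 'i%C * (2 * pi)%:C) = G w) ->
  cint (- pi) pi (fun t => G (s%:C + 'i%C * t%:C)) =
  cint (- pi) pi (fun t => G (s'%:C + 'i%C * t%:C)).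
Proof.
move=> hG per.
have pp : - pi <= pi :> R by have := @pi_gt0 R; lra.
wlog : s s' / s <= s'.
  move=> W; case: (leP s s') => [/W //|/ltW /W ->//].
move=> ss'; have := rect_int_hol hG ss' pp; rewrite /rect_int.
have -> : cint s s' (fun t => G ('i%C * pi%:C + 1 * t%:C)) =
    cint s s' (fun t => G ('i%C * (- pi)%:C + 1 * t%:C)).
  congr cint; apply/funext => t.
  rewrite -[in RHS]per; congr G; rewrite mulr_natl mulr2n !rmorphD rmorphN /=; ring.
rewrite subrr add0r => /eqP; rewrite mulf_eq0 subr_eq0 => /orP[|/eqP ->//].
by rewrite eq_complex /= oner_eq0 andbF.
Qed.

End Goursat.
(** * Uniqueness of Fourier coefficients *)
Section Fourier.
Variable R : realType.
Local Notation C := R[i].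
Local Notation mu := (@lebesgue_measure R).

Lemma ccontinuous_bounded (g : R -> C) (a b : R) : a <= b -> ccontinuous g ->
  exists B, forall t, a <= t <= b -> normc (g t) <= B.
Proof.
move=> ab [c1 c2].
pose f t := `|complex.Re (g t)| + `|complex.Im (g t)|.
have cf : continuous f.
  move=> t; apply: (@cvgD _ R^o).
    by apply: (@cvg_norm _ R^o); exact: c1.
  by apply: (@cvg_norm _ R^o); exact: c2.
have [c _ H] := EVT_max ab (continuous_subspaceT cf).
exists (f c) => t ht; apply: le_trans (normc_le_ReIm _) (H t _).
by rewrite in_itv.
Qed.

Definition cis (t : R) : C := expc ('i%C * t%:C).

Lemma cisE t : cis t = cos t +i* sin t.
Proof. exact: expc_i. Qed.

Lemma cisD t u : cis (t + u) = cis t * cis u.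
Proof. by rewrite /cis rmorphD mulrDr expcD. Qed.

Lemma cis0 : cis 0 = 1.
Proof. by rewrite cisE cos0 sin0. Qed.

Lemma cisNK t : cis t * cis (- t) = 1.
Proof. by rewrite -cisD subrr cis0. Qed.

Lemma conj_cis t : (cis t)^*%C = cis (- t).
Proof. by rewrite !cisE cosN sinN. Qed.

Lemma normc_cis t : normc (cis t) = 1.
Proof. by rewrite normc_expc; simpc; rewrite expR0. Qed.

Lemma cisD2pi t : cis (t + 2 * pi) = cis t.
Proof. by rewrite !cisE mulr_natl cosD2pi sinD2pi. Qed.

Lemma ccontinuous_cisX n : ccontinuous (fun t : R => cis t ^+ n).
Proof.
have := hol_ccontinuous 0 'i%C (holX n (@hol_expc R)).
by rewrite (_ : (fun _ => _) = fun t => cis t ^+ n) //;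
  apply/funext => t; rewrite add0r.
Qed.

Lemma ccontinuous_cisNX n : ccontinuous (fun t : R => cis (- t) ^+ n).
Proof.
have := hol_ccontinuous 0 (- 'i%C) (holX n (@hol_expc R)).
by rewrite (_ : (fun _ => _) = fun t => cis (- t) ^+ n) //;
  apply/funext => t; rewrite add0r /cis rmorphN mulrN mulNr.
Qed.

Lemma cisMn t n : cis (t *+ n) = cis t ^+ n.
Proof.
elim: n => [|n IH]; first by rewrite mulr0n cis0 expr0.
by rewrite mulrS cisD IH exprS.
Qed.

Lemma cis2pi : cis (2 * pi) = 1.
Proof. by rewrite -[2 * pi]add0r cisD2pi cis0. Qed.

(** Contour shift multiplies this integral by [expR r], which forces it to
    vanish unless [r = 0]. *)
Lemma cint_cis (r : R) : r != 0 -> cis (r * (2 * pi)) = 1 ->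
  cint (- pi) pi (fun t => cis (r * t)) = 0.
Proof.
move=> r0 hr; pose G w := expc (r%:C * w).
have hG : hol G := hol_comp (holM (@hol_cst _ r%:C) (@hol_id _)) (@hol_expc _).
have per (w : C) : G (w + 'i%C * (2 * pi)%:C) = G w.
  by rewrite /G mulrDr expcD mulrCA -rmorphM -/(cis _) hr mulr1.
have cc : ccontinuous (fun t : R => cis (r * t)).
  have := hol_ccontinuous 0 'i%C hG; rewrite (_ : (fun _ => _) = fun t => cis (r * t)) //.
  by apply/funext => t; rewrite add0r /G mulrCA -rmorphM.
have := cint_vertical_shift 0 1 hG per.
have -> : (fun t : R => G (0%:C + 'i%C * t%:C)) = fun t => cis (r * t).
  by apply/funext => t; rewrite add0r /G mulrCA -rmorphM.
have -> : (fun t : R => G (1%:C + 'i%C * t%:C)) = fun t => (expR r)%:C * cis (r * t).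
  by apply/funext => t; rewrite /G mulrDr expcD mulr1 expc_real mulrCA -rmorphM.
rewrite cintZ //.
set I := cint _ _ _ => /eqP; rewrite -subr_eq0 -{1}[I]mul1r -mulrBl mulf_eq0.
case/orP => [|/eqP //]; rewrite subr_eq0 => /eqP [] /esym/eqP.
by rewrite -[X in _ == X]expR0 (inj_eq (@expR_inj _)) (negPf r0).
Qed.

Lemma cint_cisX_cisNX (a b : nat) :
  cint (- pi) pi (fun t => cis t ^+ a * cis (- t) ^+ b) =
  if a == b then (2 * pi)%:C else 0.
Proof.
have E t : cis t ^+ a * cis (- t) ^+ b = cis ((a%:R - b%:R) * t).
  by rewrite -!cisMn -cisD mulrBl !mulr_natl mulNrn.
rewrite (_ : (fun _ => _) = fun t => cis ((a%:R - b%:R) * t)); last first.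
  by apply/funext => t; exact: E.
case: eqP => [->|/eqP ab].
  rewrite (_ : (fun _ => _) = fun=> 1); last first.
    by apply/funext => t; rewrite subrr mul0r cis0.
  rewrite cint_cst ?mulr1; first by rewrite opprK mulr_natl mulr2n.
  by have := @pi_gt0 R; lra.
apply: cint_cis; first by rewrite subr_eq0 eqr_nat.
have N1 : cis (- (2 * pi)) = 1 by have := cisNK (2 * pi); rewrite cis2pi mul1r.
by rewrite -E N1 cis2pi !expr1n mulr1.
Qed.

Section Fejer.
Variables (G : C -> C) (s t0 : R).
Hypothesis hG : hol G.
Hypothesis perG : forall w, G (w + 'i%C * (2 * pi)%:C) = G w.
Hypothesis ht0 : - pi <= t0 <= pi.

Let h t := G (s%:C + 'i%C * t%:C).

Lemma h_cont : ccontinuous h.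
Proof. exact: hol_ccontinuous. Qed.

Lemma hD2pi t : h (t + 2 * pi) = h t.
Proof. by rewrite /h rmorphD mulrDr addrA perG. Qed.

Lemma cis_sub1_ge (u d : R) : 0 < d -> d <= `|u| -> `|u| <= pi ->
  1 - cos d <= normc (cis u - 1).
Proof.
move=> d0 du upi; apply: le_trans (Re_le_normc _).
rewrite cisE /= -normrN opprB; apply: le_trans (ler_norm _).
rewrite lerB // -(cos_norm u).
have : d <= pi by exact: le_trans upi.
rewrite le_eqVlt in du; case/orP: du => [/eqP <- //|du dpi].
by apply: ltW; rewrite ltr_cos // in_itv /= ?normr_ge0 ?(ltW d0).
Qed.

Lemma cis_sub1_near0 : exists2 d : R, 0 < d &
  forall u, `|u| < d -> `|u| <= 2 * normc (cis u - 1).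
Proof.
have half0 : 0 < 1 / 2 :> R by lra.
have [d d0 H] := is_derive_eps (is_derive_sin (0 : R)) half0.
exists d => // u /H; rewrite add0r sin0 cos0 subr0 mul1r => le.
have : `|sin u| <= normc (cis u - 1).
  apply: le_trans (Im_le_normc _); by rewrite cisE /= subr0.
have : `|u| <= `|sin u| + `|sin u - u|.
  by rewrite -{1}[u](subKr (sin u)) (le_trans (ler_normB _ _)).
move: le; set x := `|_|; set y := `|_|; set z := `|_|; set w := normc _; lra.
Qed.

(** Away from [t0] modulo the period [cis (t - t0)] stays away from [1], and
    near [t0] both sides are comparable to the distance from [t0]. *)
Lemma lipschitz_cis : exists2 L, 0 <= L & forall t, - pi <= t <= pi ->
  normc (h t - h t0) <= L * normc (cis (t - t0) - 1).
Proof.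
have pp : - pi <= pi :> R by have := @pi_gt0 R; lra.
have [B HB] := ccontinuous_bounded pp h_cont.
have B0 : 0 <= B by apply: le_trans (HB _ ht0); exact: normc_ge0.
have [L1 L10 [d1 d10 H1]] := hol_lipschitz (s%:C + 'i%C * t0%:C) hG.
have [d2 d20 H2] := cis_sub1_near0.
pose d := Num.min pi (Num.min d1 d2).
have d0 : 0 < d by rewrite !lt_min pi_gt0 d10.
have dpi : d <= pi by rewrite ge_min lexx.
have cd : 0 < 1 - cos d.
  by rewrite subr_gt0 -cos0 ltr_cos // in_itv /= ?lexx ?pi_ge0 // ltW.
pose L := 2 * L1 + (2 * B) / (1 - cos d).
have L2 : 0 <= (2 * B) / (1 - cos d) by rewrite divr_ge0 ?mulr_ge0 // ltW.
have L0 : 0 <= L by rewrite addr_ge0 // mulr_ge0.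
exists L => // t ht.
(* It suffices to treat [t = t0 + u] with [u] in [-pi, pi]: other values of
   [t - t0] differ from such a [u] by one period. *)
have key u : `|u| <= pi -> normc (h (t0 + u)) <= B ->
    normc (h (t0 + u) - h t0) <= L * normc (cis u - 1).
  move=> upi hu; have [ud|ud] := ltP `|u| d.
    move: ud; rewrite !lt_min => /and3P[_ u1 u2].
    apply: le_trans (_ : 2 * L1 * normc (cis u - 1) <= _); last first.
      by rewrite ler_wpM2r ?normc_ge0 // lerDl.
    have := H1 ('i%C * u%:C); rewrite normcM normc_i mul1r normc_real => /(_ u1).
    rewrite /h rmorphD mulrDr addrA => le; apply: le_trans le _.
    by rewrite [2 * L1]mulrC -mulrA ler_wpM2l // H2.
  apply: le_trans (_ : (2 * B) / (1 - cos d) * normc (cis u - 1) <= _); last first.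
    by rewrite ler_wpM2r ?normc_ge0 // lerDr mulr_ge0.
  apply: le_trans (normcB_le _ _) _; apply: le_trans (_ : 2 * B <= _).
    by rewrite mulr_natl mulr2n; apply: lerD => //; exact: HB.
  rewrite mulrAC ler_pdivlMr // ler_wpM2l ?mulr_ge0 //.
  exact: cis_sub1_ge.
have e1 : t0 + (t - t0) = t by rewrite addrC subrK.
have [/andP[t1 t2] /andP[t01 t02]] := (ht, ht0).
have [c1|c1] := leP `|t - t0| pi.
  by rewrite -{1}e1; apply: key => //; rewrite e1; exact: HB.
have [c2|c2] := leP 0 (t - t0).
  rewrite (ger0_norm c2) in c1.
  have e2 : t = t0 + (t - t0 - 2 * pi) + 2 * pi by ring.
  have e3 : cis (t - t0) = cis (t - t0 - 2 * pi).
    by rewrite -[RHS]cisD2pi; congr cis; ring.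
  have e4 : h t = h (t0 + (t - t0 - 2 * pi)) by rewrite {1}e2 hD2pi.
  rewrite e3 e4; apply: key; last by rewrite -e4; exact: HB.
  by rewrite ler_norml; apply/andP; split; lra.
rewrite (ltr0_norm c2) in c1.
have e3 : cis (t - t0) = cis (t - t0 + 2 * pi) by rewrite cisD2pi.
have e4 : h t = h (t0 + (t - t0 + 2 * pi)).
  by rewrite -hD2pi; congr h; ring.
rewrite e3 e4; apply: key; last by rewrite -e4; exact: HB.
by rewrite ler_norml; apply/andP; split; lra.
Qed.

Hypothesis hpos : forall m : nat, cint (- pi) pi (fun t => h t * cis t ^+ m) = 0.
Hypothesis hneg : forall m : nat, cint (- pi) pi (fun t => h t * cis (- t) ^+ m) = 0.

Lemma cint_h_cisX_cisNX (a b : nat) :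
  cint (- pi) pi (fun t => h t * (cis t ^+ a * cis (- t) ^+ b)) = 0.
Proof.
have [ba|ab] := leqP b a.
  rewrite -[RHS](hpos (a - b)); congr cint; apply/funext => t.
  by rewrite -{1}(subnK ba) exprD -!mulrA -exprMn cisNK expr1n mulr1.
rewrite -[RHS](hneg (b - a)); congr cint; apply/funext => t.
rewrite -{1}(subnKC (ltnW ab)) exprD (mulrA (cis t ^+ a)) -exprMn cisNK.
by rewrite expr1n mul1r.
Qed.

Let D (M : nat) t : C := \sum_(m < M) cis (t - t0) ^+ m.

Lemma D_sqr M t : (normc (D M t) ^+ 2)%:C =
  \sum_(a < M) \sum_(b < M)
    (cis (- t0) ^+ a * cis t0 ^+ b) * (cis t ^+ a * cis (- t) ^+ b).
Proof.
have -> (x : C) : (normc x ^+ 2)%:C = x * x^*%C.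
  by rewrite rmorphXn; exact: sqr_normc.
rewrite /D rmorph_sum /=.
rewrite mulr_suml; apply: eq_bigr => a _; rewrite mulr_sumr.
apply: eq_bigr => b _; rewrite rmorphXn /= conj_cis opprB !cisD !exprMn; ring.
Qed.

Lemma D_geom M t : normc (cis (t - t0) - 1) * normc (D M t) <= 2.
Proof.
rewrite -normcM -subrX1 (le_trans (normcB_le _ _)) //.
by rewrite normcX normc_cis expr1n normc1.
Qed.

Lemma ccont_cis2 a b : ccontinuous (fun t => cis t ^+ a * cis (- t) ^+ b).
Proof. exact: ccontinuousM (@ccontinuous_cisX a) (@ccontinuous_cisNX b). Qed.

Lemma cint_h_fejer M :
  cint (- pi) pi (fun t => h t * (normc (D M t) ^+ 2)%:C) = 0.
Proof.
have cc a b : ccontinuous (fun t => (cis (- t0) ^+ a * cis t0 ^+ b) *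
    (h t * (cis t ^+ a * cis (- t) ^+ b))).
  apply: ccontinuousM (@ccontinuous_cst _ _) _.
  exact: ccontinuousM h_cont (ccont_cis2 a b).
rewrite (_ : (fun _ => _) = fun t => \sum_(a < M) \sum_(b < M)
    (cis (- t0) ^+ a * cis t0 ^+ b) * (h t * (cis t ^+ a * cis (- t) ^+ b))).
  rewrite cint_sum => [|a]; last by apply: ccontinuous_sum => b.
  rewrite big1 // => a _; rewrite cint_sum //.
  rewrite big1 // => b _; rewrite cintZ ?cint_h_cisX_cisNX ?mulr0 //.
  exact: ccontinuousM h_cont (ccont_cis2 a b).
apply/funext => t; rewrite D_sqr mulr_sumr; apply: eq_bigr => a _.
by rewrite mulr_sumr; apply: eq_bigr => b _; rewrite mulrCA.
Qed.

Lemma cint_fejer M :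
  cint (- pi) pi (fun t => (normc (D M t) ^+ 2)%:C) = (2 * pi * M%:R)%:C.
Proof.
have cc a b : ccontinuous (fun t => (cis (- t0) ^+ a * cis t0 ^+ b) *
    (cis t ^+ a * cis (- t) ^+ b)).
  exact: ccontinuousM (@ccontinuous_cst _ _) (ccont_cis2 a b).
rewrite (_ : (fun _ => _) = fun t => \sum_(a < M) \sum_(b < M)
    (cis (- t0) ^+ a * cis t0 ^+ b) * (cis t ^+ a * cis (- t) ^+ b)); last first.
  by apply/funext => t; exact: D_sqr.
rewrite cint_sum => [|a]; last by apply: ccontinuous_sum => b.
rewrite (eq_bigr (fun=> (2 * pi)%:C)) => [|a _].
  by rewrite sumr_const card_ord mulr_natr rmorphMn.
rewrite cint_sum // (bigD1 a) //= cintZ; last exact: ccont_cis2.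
rewrite cint_cisX_cisNX eqxx -exprMn mulrC -[cis t0]/(cis t0) [cis (- t0) * _]mulrC cisNK.
rewrite expr1n mulr1 big1 ?addr0 // => b ba.
rewrite cintZ ?cint_cisX_cisNX; last exact: ccont_cis2.
by rewrite eq_sym (negPf (_ : b != a :> nat)) // mulr0.
Qed.

Lemma D_cont M : ccontinuous (fun t => (normc (D M t) ^+ 2)%:C).
Proof.
rewrite (_ : (fun _ => _) = fun t => \sum_(a < M) \sum_(b < M)
    (cis (- t0) ^+ a * cis t0 ^+ b) * (cis t ^+ a * cis (- t) ^+ b)); last first.
  by apply/funext => t; exact: D_sqr.
apply: ccontinuous_sum => a; apply: ccontinuous_sum => b.
exact: ccontinuousM (@ccontinuous_cst _ _) (ccont_cis2 a b).
Qed.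

(** The Fejer kernel [normc (D M t) ^+ 2 / M] has integral [2 pi] and is
    orthogonal to [h]. As [normc (h t - h t0) * normc (D M t)] is bounded by [2 L],
    the integral of [h t0 - h t] against the kernel is controlled by the integral
    of [normc (D M t)] over [M]; the inequality [2 x <= k + x ^+ 2 / k] with
    [M = k ^ 2] bounds the latter by the integral of the kernel itself, and the
    result is of order [1 / k]. *)
Lemma fourier_uniqueness : h t0 = 0.
Proof.
have pp : - pi <= pi :> R by have := @pi_gt0 R; lra.
have [L L0 HL] := lipschitz_cis.
have bound k : (0 < k)%N -> normc (h t0) * k%:R <= 4 * L.
  move=> k0; have kR : 0 < k%:R :> R by rewrite ltr0n.
  pose M := (k * k)%N; pose K t := normc (D M t) ^+ 2.
  have [cK1 cK2] := D_cont M.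
  have cK : continuous K := cK1.
  have IK : \int[mu]_(t in `[(- pi)%R, pi]) K t = 2 * pi * M%:R.
    by have := cint_fejer M; rewrite /cint => -[].
  have E : cint (- pi) pi (fun t => (h t0 - h t) * (K t)%:C) =
      h t0 * (2 * pi * M%:R)%:C.
    rewrite (_ : (fun _ => _) = fun t => h t0 * (K t)%:C + (-1) * (h t * (K t)%:C)).
      rewrite cintD; first last.
      - apply: ccontinuousM (@ccontinuous_cst _ _) _.
        exact: ccontinuousM h_cont (D_cont M).
      - exact: ccontinuousM (@ccontinuous_cst _ _) (D_cont M).
      rewrite !cintZ; first last.
      - exact: D_cont.
      - exact: ccontinuousM h_cont (D_cont M).
      by rewrite cint_h_fejer cint_fejer mulr0 addr0.
    by apply/funext => t; ring.
  pose B t := L * k%:R + L / k%:R * K t.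
  have cB : continuous B.
    move=> t; apply: (@cvgD _ R^o); first exact: cvg_cst.
    by apply: cvgM; [exact: cvg_cst|exact: cK].
  have le : normc (h t0 * (2 * pi * M%:R)%:C) <= 2 * (4 * pi * L * k%:R).
    rewrite -E.
    have -> : 4 * pi * L * k%:R = \int[mu]_(t in `[(- pi)%R, pi]) B t.
      rewrite RintegralD //; [|exact: continuous_integrable (fun=> @cvg_cst _ _ _ _ _)|]; last first.
        apply: (continuous_integrable (f := fun t => L / k%:R * K t)) => t.
        by apply: cvgM; [exact: cvg_cst|exact: cK].
      rewrite Rint_cst // RintegralZl //; last exact: continuous_integrable.
      by rewrite IK /M natrM; field; rewrite gt_eqF.
    apply: normc_cint_le => //.
      apply: ccontinuousM _ (D_cont M).
      rewrite (_ : (fun _ => _) = fun t => h t0 + (-1) * h t).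
        apply: ccontinuousD (@ccontinuous_cst _ _) _.
        exact: ccontinuousM (@ccontinuous_cst _ _) h_cont.
      by apply/funext => t; rewrite mulN1r.
    move=> t /HL; rewrite normcM normcB normc_real /K => lt.
    rewrite ger0_norm ?sqr_ge0 // /B /K.
    have := D_geom M t; set x := normc (D M t) in lt *.
    set y := normc (cis _ - 1) in lt * => yx.
    have x0 : 0 <= x := normc_ge0 _.
    apply: le_trans (_ : L * y * x ^+ 2 <= _).
      by rewrite ler_wpM2r ?sqr_ge0 // normcB.
    apply: le_trans (_ : L * (2 * x) <= _).
      by rewrite -mulrA ler_wpM2l // expr2 mulrA ler_wpM2r.
    rewrite -[L / _ * _]mulrA -mulrDr ler_wpM2l //.
    rewrite -subr_ge0.
    have -> : k%:R + k%:R^-1 * x ^+ 2 - 2 * x = (k%:R - x) ^+ 2 / k%:R.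
      by field; rewrite gt_eqF.
    by rewrite divr_ge0 ?sqr_ge0 // ltW.
  move: le; rewrite normcM normc_real ger0_norm; last first.
    by rewrite !mulr_ge0 // ?pi_ge0.
  rewrite /M natrM.
  have -> : normc (h t0) * (2 * pi * (k%:R * k%:R)) =
    (2 * pi * k%:R) * (normc (h t0) * k%:R) by ring.
  have -> : 2 * (4 * pi * L * k%:R) = (2 * pi * k%:R) * (4 * L) by ring.
  by rewrite ler_pM2l // !mulr_gt0 // pi_gt0.
apply: eq0_normc; apply/eqP; rewrite eq_le normc_ge0 andbT leNgt.
apply/negP => h0.
pose k := (Num.bound (4 * L / normc (h t0))).+1.
have := bound k isT; rewrite leNgt => /negP; apply.
rewrite [normc _ * _]mulrC -ltr_pdivrMr //.
have q0 : 0 <= 4 * L / normc (h t0) by rewrite divr_ge0 ?mulr_ge0 // ltW.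
by apply: lt_trans (archi_boundP q0) _; rewrite ltr_nat.
Qed.

End Fejer.

End Fourier.
(** * Recurrences with exponential coefficients *)
Section Recurrence.
Variable R : realType.
Local Notation C := R[i].

(** Following the indices where the lower bound propagates, each step from [s]
    to a larger index loses a factor [B ^+ s.+1], hence [B ^+ (m ^ 2)] in total
    on the way to [m]; this is incompatible with faster decay. *)
Lemma backward_growth_vanish (c : nat -> C) (N : nat) (B : R) : 1 <= B ->
  (forall s, (N <= s)%N -> exists2 m, (s < m)%N &
     normc (c s) <= B ^+ s.+1 * normc (c m)) ->
  (forall D : R, 1 <= D -> exists N', forall m, (N' <= m)%N ->
     normc (c m) * D ^+ (m ^ 2) <= 1) ->
  forall s, (N <= s)%N -> c s = 0.
Proof.
move=> B1 step decay s Ns.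
have B0 : 0 <= B by rewrite (le_trans ler01).
have claim k : exists2 m, (s + k <= m)%N &
    normc (c s) <= normc (c m) * B ^+ (m ^ 2).
  elim: k => [|k [m sm IH]].
    by exists s; rewrite ?addn0 // ler_peMr ?normc_ge0 // exprn_ege1.
  have [|m' mm' le] := step m.
    by rewrite (leq_trans Ns) // (leq_trans _ sm) // leq_addr.
  exists m'; first by rewrite addnS (leq_ltn_trans sm).
  apply: le_trans IH _; apply: le_trans (ler_wpM2r _ le) _; first exact: exprn_ge0.
  rewrite mulrAC mulrC -exprD ler_wpM2l ?normc_ge0 // ler_weXn2l //.
  apply: leq_trans (_ : m.+1 ^ 2 <= _)%N; last by rewrite leq_exp2r.
  nia.
have D1 : 1 <= 2 * B by rewrite (le_trans B1) // ler_peMl // ler1n.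
have [N' HN'] := decay _ D1.
apply: eq0_normc; apply/eqP; rewrite eq_le normc_ge0 andbT leNgt.
apply/negP => c0.
pose k := maxn N' (Num.bound (1 / normc (c s))).
have [m km le] := claim k.
have k1 : (N' <= k)%N := leq_maxl _ _.
have k2 : (Num.bound (1 / normc (c s)) <= k)%N := leq_maxr _ _.
have Nm : (N' <= m)%N by lia.
have := HN' m Nm; rewrite exprMn mulrCA mulrC => le1.
have := le_trans (ler_wpM2r _ le) le1; rewrite exprn_ge0 // => /(_ isT).
rewrite -ler_pdivlMl // mulr1 leNgt => /negP; apply.
rewrite -[_^-1]mul1r; have q0 : 0 <= 1 / normc (c s) by rewrite divr_ge0 // ltW.
apply: lt_trans (archi_boundP q0) _; rewrite -natrX ltr_nat.
apply: leq_ltn_trans (_ : (m ^ 2 < _)%N); last exact: ltn_expl.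
by nia.
Qed.

Lemma poly_bounded_unit (P : {poly C}) : exists2 K : R, 0 <= K &
  forall t, normc t <= 1 -> normc P.[t] <= K.
Proof.
elim/poly_ind: P => [|P c [K K0 IH]].
  by exists 0 => // t _; rewrite horner0 normc0.
exists (K + normc c) => [|t t1]; first by rewrite addr_ge0 ?normc_ge0.
rewrite hornerMXaddC (le_trans (normcD_le _ _)) // lerD2r normcM.
by rewrite -[K]mulr1 ler_pM ?normc_ge0 // IH.
Qed.

Lemma expr_small (v e : R) : 0 < v -> v < 1 -> 0 < e ->
  exists N, forall s, (N <= s)%N -> v ^+ s <= e.
Proof.
move=> v0 v1 e0; have nv : `|v| < 1 by rewrite gtr0_norm.
have /cvgrPdist_le /(_ e e0) [N _ H] := cvg_expr nv.
exists N => s Ns; have := H s Ns; rewrite /= sub0r normrN.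
by rewrite ger0_norm // exprn_ge0 // ltW.
Qed.

(** Near [0] a nonzero polynomial is comparable to its term of lowest order. *)
Lemma poly_lower_bound (P : {poly C}) (v : R) : 0 < v -> v < 1 -> P != 0 ->
  exists kappa : R, exists d N : nat, 0 < kappa /\
    forall s, (N <= s)%N -> kappa * (v ^+ d) ^+ s <= normc P.[(v ^+ s)%:C].
Proof.
move=> v0 v1; elim/poly_ind: P => [|P c IH]; first by rewrite eqxx.
have [-> |c0] := eqVneq c 0.
  rewrite addr0 => PX; have P0 : P != 0 by apply: contraNneq PX => ->; rewrite mul0r.
  have [k [d [N [k0 H]]]] := IH P0; exists k, d.+1, N; split => // s Ns.
  rewrite hornerMX normcM normc_real ger0_norm ?exprn_ge0 ?(ltW v0) //.
  by rewrite exprSr exprMn mulrA ler_wpM2r ?exprn_ge0 ?(ltW v0) // H.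
move=> _; have [K K0 HK] := poly_bounded_unit P.
have nc0 : 0 < normc c by rewrite normc_gt0.
have K1 : 0 < 2 * (K + 1) by rewrite mulr_gt0 // ltr_wpDl.
have [N HN] := expr_small v0 v1 (divr_gt0 nc0 K1).
exists (normc c / 2), 0%N, N; split; first by rewrite divr_gt0.
move=> s /HN le; rewrite expr0 expr1n mulr1 hornerMXaddC.
have vs1 : `|v ^+ s| <= 1.
  by rewrite ger0_norm ?exprn_ge0 ?exprn_ile1 // ltW.
set x := _.[_]; set t := (_)%:C.
have xK : normc x <= K by apply: HK; rewrite normc_real.
have tri : normc c <= normc (x * t + c) + normc (x * t).
  by rewrite -{1}[c](addKr (x * t)) addrC (le_trans (normcB_le _ _)).
have xt : normc (x * t) <= normc c / 2.
  rewrite normcM normc_real ger0_norm ?exprn_ge0 ?(ltW v0) //.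
  apply: le_trans (_ : (K + 1) * v ^+ s <= _).
    rewrite ler_wpM2r ?exprn_ge0 ?(ltW v0) // (le_trans xK) // lerDl //.
  rewrite mulrC -ler_pdivlMr ?ltr_wpDl // (le_trans le) //.
  by rewrite le_eqVlt; apply/orP; left; apply/eqP; field; rewrite gt_eqF ?ltr_wpDl.
move: tri xt; set A := normc _; set B := normc (x * t); set D := normc _; lra.
Qed.

(** Among the [l] with [P l != 0] the largest one carries the value of [c] of
    smallest index; solving for it, the polynomial lower bound shows that some
    later value is smaller by at most a factor [B ^+ s.+1]. *)
Lemma recurrence_vanish (P : nat -> {poly C}) (L l0 : nat) (v : R)
    (c : nat -> C) : 0 < v -> v < 1 -> (l0 <= L)%N -> P l0 != 0 ->
  (forall m, (L <= m)%N ->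
    \sum_(l < L.+1) (P l).[(v ^+ (m - l))%:C] * c (m - l)%N = 0) ->
  (forall D : R, 1 <= D -> exists N', forall m, (N' <= m)%N ->
     normc (c m) * D ^+ (m ^ 2) <= 1) ->
  exists N, forall s, (N <= s)%N -> c s = 0.
Proof.
move=> v0 v1 l0L Pl0 rec decay.
pose p l := (l <= L)%N && (P l != 0).
have exp : exists l, p l by exists l0; rewrite /p l0L.
have ubp l : p l -> (l <= L)%N by case/andP.
case: (ex_maxnP exp ubp) => k /andP[kL Pk] kmax.
have [kappa [d [N [k0 low]]]] := poly_lower_bound v0 v1 Pk.
have /choice[K HK] : forall l, exists K : R, 0 <= K /\
    forall t, normc t <= 1 -> normc (P l).[t] <= K.
  by move=> l; have [K K0 HK] := poly_bounded_unit (P l); exists K.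
pose S := \sum_(l < L.+1) K l.
have S0 : 0 <= S by apply: sumr_ge0 => l _; case: (HK l).
pose a := v ^+ d.
have a0 : 0 < a by rewrite exprn_gt0.
have a1 : a <= 1 by rewrite exprn_ile1 // ltW.
have Sk : 1 <= 1 + S / kappa by rewrite lerDl divr_ge0 // ltW.
pose B := a^-1 * (1 + S / kappa).
have aV1 : 1 <= a^-1 by rewrite -{1}[1]invr1 lef_pV2 ?posrE.
have B1 : 1 <= B by apply: le_trans aV1 _; rewrite ler_peMr // invr_ge0 ltW.
exists (maxn L N); apply: (backward_growth_vanish B1) decay => s.
rewrite geq_max => /andP[Ls Ns].
have [cs0|cs0] := eqVneq (c s) 0.
  exists s.+1 => //; rewrite cs0 normc0 mulr_ge0 ?normc_ge0 //.
  by rewrite exprn_ge0 // (le_trans ler01).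
have ncs : 0 < normc (c s) by rewrite normc_gt0.
apply: contrapT => nex.
have big m : (s < m)%N -> B ^+ s.+1 * normc (c m) <= normc (c s).
  move=> sm; rewrite leNgt; apply/negP => /ltW le.
  by apply: nex; exists m.
have B0 : 0 < B by rewrite (lt_le_trans ltr01).
have vs1 j : normc ((v ^+ j)%:C : C) <= 1.
  by rewrite normc_real ger0_norm ?exprn_ge0 ?exprn_ile1 // ltW.
have := rec (s + k)%N (leq_trans Ls (leq_addr _ _)).
pose k' : 'I_L.+1 := Ordinal (kL : (k < L.+1)%N).
rewrite (bigD1 k') //= addnK => /eqP; rewrite addr_eq0 => /eqP E.
have le : kappa * a ^+ s * normc (c s) * B ^+ s.+1 <= S * normc (c s).
  apply: le_trans (_ : normc ((P k).[(v ^+ s)%:C] * c s) * B ^+ s.+1 <= _).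
    rewrite ler_wpM2r ?exprn_ge0 ?(ltW B0) // normcM ler_wpM2r ?normc_ge0 //.
    exact: low.
  rewrite E normc_opp -ler_pdivlMr ?exprn_gt0 //.
  apply: le_trans (normc_sum _ _ _) _.
  rewrite ler_pdivlMr ?exprn_gt0 // /S !mulr_suml.
  rewrite [leRHS](bigD1 k') //= -[leLHS]add0r; apply: lerD.
    by rewrite mulr_ge0 ?normc_ge0 //; case: (HK k).
  apply: ler_sum => l lk; have [Kl0 HKl] := HK l.
  have [->|Pl] := eqVneq (P l) 0.
    by rewrite horner0 mul0r normc0 mul0r mulr_ge0 ?normc_ge0.
  have lk' : (l < k)%N.
    rewrite ltn_neqAle kmax ?andbT; last by rewrite /p -ltnS ltn_ord.
    by apply: contra lk => /eqP lk; apply/eqP/val_inj.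
  rewrite normcM -mulrA ler_pM ?normc_ge0 ?mulr_ge0 ?normc_ge0 ?exprn_ge0 ?(ltW B0) //.
    exact: HKl.
  rewrite mulrC; apply: big.
  by rewrite -addnBA ?(ltnW lk') // -[ltnLHS]addn0 ltn_add2l subn_gt0.
move: le; rewrite -[leLHS]mulrA [normc _ * _]mulrC mulrA ler_pM2r // leNgt.
move=> /negP; apply.
apply: lt_le_trans (_ : kappa * (1 + S / kappa) <= _).
  by rewrite mulrDr mulr1 mulrCA mulfV ?gt_eqF // mulr1 ltrDr.
rewrite -mulrA ler_pM2l // /B; set X := 1 + _ in Sk *.
have -> : a ^+ s * (a^-1 * X) ^+ s.+1 = a^-1 * X ^+ s * X.
  rewrite exprS exprMn exprVn; field.
  by rewrite ?expf_neq0 ?gt_eqF.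
rewrite ler_peMl ?(le_trans ler01) //.
by rewrite mulr_ege1 // exprn_ege1.
Qed.

End Recurrence.
(** * From the Askey-Wilson equation to a q-difference equation *)
Section QDifference.
Variables (R : realType) (q : R).
Hypotheses (hq0 : 0 < q) (hq1 : q < 1).
Local Notation C := R[i].
Local Notation v := (Num.sqrt q).

Lemma sqrtq_gt0 : 0 < v.
Proof. by rewrite sqrtr_gt0. Qed.

Lemma sqrtq_lt1 : v < 1.
Proof. by rewrite -sqrtr1 ltr_sqrt. Qed.

(** The shift [w + lam] realises the multiplication of [expc w] by [sqrt q]. *)
Definition lam : R := ln v.

Lemma expR_lam : expR lam = v.
Proof. by rewrite lnK // posrE sqrtq_gt0. Qed.

Lemma lam_neq0 : lam != 0.
Proof. by rewrite /lam ln_eq0 ?sqrtq_gt0 // lt_eqF // sqrtq_lt1. Qed.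

Definition ccosh (w : C) : C := joukowski (expc w).

(** Off these vertical lines no zero of [sinh] is met when iterating the
    operator. *)
Definition off_lattice (w : C) := forall j : int, complex.Re w != j%:~R * lam.

Lemma off_latticeD w (k : int) :
  off_lattice w -> off_lattice (w + (k%:~R * lam)%:C).
Proof.
move=> H j; have := H (j - k); apply: contraNneq.
case: w {H} => a b /= E; apply/eqP; rewrite rmorphB /= mulrBl -E; ring.
Qed.

Lemma off_latticeDlam w : off_lattice w -> off_lattice (w + lam%:C).
Proof. by move=> /(off_latticeD 1); rewrite mul1r. Qed.

Lemma off_latticeBlam w : off_lattice w -> off_lattice (w - lam%:C).
Proof. by move=> /(off_latticeD (-1)); rewrite mulN1r rmorphN. Qed.

Lemma expc_shift w : expc (w + lam%:C) = v%:C * expc w.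
Proof. by rewrite expcD expc_real expR_lam mulrC. Qed.

Lemma expc_shiftN w : expc (w - lam%:C) = v%:C^-1 * expc w.
Proof. by rewrite expcD expcN expc_real expR_lam mulrC. Qed.

Lemma off_lattice_sqr_neq1 w : off_lattice w -> expc w ^+ 2 - 1 != 0.
Proof.
move=> /(_ 0); rewrite mul0r; apply: contraNneq => /eqP.
rewrite subr_eq0 => /eqP /(congr1 (@normc R)); rewrite normcX normc1 normc_expc.
move/eqP; rewrite -expR0 -expRM_natl => /eqP/expR_inj/eqP.
by rewrite mulf_eq0 pnatr_eq0.
Qed.

(** In the variable [w] the operator is a difference of two shifts, divided by
    [sinh w] up to a constant. *)
Lemma Dq_ccosh (f : C -> C) w : off_lattice w ->
  (expc w ^+ 2 - 1) * ((v%:C - v%:C^-1) / 2) * Dq q f (ccosh w) =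
  expc w * (f (ccosh (w + lam%:C)) - f (ccosh (w - lam%:C))).
Proof.
move=> hw; have z0 := expc_neq0 w; have z2 := off_lattice_sqr_neq1 hw.
have v0 : v%:C != 0 :> C by rewrite eq_complex /= negb_and gt_eqF ?sqrtq_gt0.
have z1 : expc w != 1 by apply: contra z2 => /eqP ->; rewrite expr1n subrr.
have zN1 : expc w != -1 by apply: contra z2 => /eqP ->; rewrite sqrrN expr1n subrr.
rewrite (@DqE _ q f _ (expc w)) //; first last.
- apply: contra zN1 => /eqP E; rewrite -subr_eq0 opprK -sqrf_eq0; apply/eqP.
  have -> : (expc w + 1) ^+ 2 = 2 * expc w * (ccosh w + 1).
    by rewrite /ccosh /joukowski; field.
  by rewrite E addNr mulr0.
- apply: contra z1 => /eqP E; rewrite -subr_eq0 -sqrf_eq0; apply/eqP.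
  have -> : (expc w - 1) ^+ 2 = 2 * expc w * (ccosh w - 1).
    by rewrite /ccosh /joukowski; field.
  by rewrite E subrr mulr0.
rewrite /AW_quotient /qhalf -expc_shift -expc_shiftN -!/(ccosh _).
set F := _ - _.
have v2 : v%:C ^+ 2 - 1 != 0 :> C.
  rewrite -rmorphXn -(rmorph1 (real_complex R)) -rmorphB eq_complex /= negb_and.
  rewrite subr_eq0 lt_eqF // exprn_ilt1 // ?ltW ?sqrtq_gt0 //.
  exact: sqrtq_lt1.
have -> : ccosh (w + lam%:C) - ccosh (w - lam%:C) =
    (expc w ^+ 2 - 1) * (v%:C ^+ 2 - 1) / (2 * v%:C * expc w).
  by rewrite /ccosh expc_shift expc_shiftN /joukowski; field; rewrite v0 z0.
by field; rewrite z0 v0 z2 v2.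
Qed.

Lemma poly_eq0_fun (p : {poly C}) : (forall x, p.[x] = 0) -> p = 0.
Proof.
move=> H; apply/eqP; apply: contraT => p0.
pose s := [seq (k%:R : C) | k <- iota 0 (size p)].
have : (size s < size p)%N.
  apply: max_poly_roots p0 _ _; first by apply/allP => x _; rewrite /root H.
  by rewrite map_inj_uniq ?iota_uniq // => a b /eqP; rewrite eqr_nat => /eqP.
by rewrite size_map size_iota ltnn.
Qed.

(** A polynomial in [joukowski z] is a Laurent polynomial in [z]; the power of
    [z] clears its denominator. *)
Lemma poly_joukowski (a : {poly C}) : exists A d, (a != 0 -> A != 0) /\
  forall z, z != 0 -> A.[z] = z ^+ d * a.[joukowski z].
Proof.
have [A [d H]] : exists (A : {poly C}) d,
    forall z, z != 0 -> A.[z] = z ^+ d * a.[joukowski z].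
  elim/poly_ind: a => [|p c [A [d IH]]].
    by exists 0, 0%N => z _; rewrite !horner0 mulr0.
  exists (A * ('X^2 + 1) * (2^-1)%:P + c *: 'X^(d.+1)), d.+1 => z z0.
  have E : z ^+ 2 + 1 = 2 * z * joukowski z by rewrite /joukowski; field.
  rewrite hornerD !hornerM hornerZ hornerC !hornerXn hornerD hornerXn IH //.
  rewrite hornerMXaddC -[1]/(1%:P) hornerC E exprS.
  set X := joukowski z; set Y := p.[X]; set Z := z ^+ d.
  by field.
exists A, d; split => //; apply: contraNneq => A0.
apply/eqP/poly_eq0_fun => x; rewrite -(joukowski_invK x).
have z0 := joukowski_inv_neq0 x.
have /esym/eqP := H _ z0; rewrite A0 horner0 mulf_eq0 expf_eq0 (negPf z0) andbF.
by move/eqP.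
Qed.

Section Representation.
Variable y : C -> C.
Let G w := y (ccosh w).

(** Up to a polynomial factor in [expc w], [phi] is the combination with
    coefficients polynomial in [expc w] of the values of [G] on the [lam]-chain of
    radius [k] around [w]; [top] records whether the end of the chain really
    occurs. *)
Definition chain_rep (k : nat) (phi : C -> C) (top : bool) :=
  exists (Q : {poly C}) (B : nat -> {poly C}), [/\ Q != 0,
    (B k.*2 != 0) = top &
    forall w, off_lattice w -> Q.[expc w] * phi w =
      \sum_(j < k.*2.+1) (B j).[expc w] * G (w + ((j%:R - k%:R) * lam)%:C)].

Lemma chain_rep0 k : chain_rep k (fun=> 0) false.
Proof.
exists 1, (fun=> 0); split; rewrite ?oner_eq0 ?eqxx // => w _.
by rewrite mulr0 big1 // => j _; rewrite horner0 mul0r.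
Qed.

Lemma eq_chain_rep k phi psi t : (forall w, off_lattice w -> phi w = psi w) ->
  chain_rep k phi t -> chain_rep k psi t.
Proof.
move=> E [Q [B [Q0 Bt H]]]; exists Q, B; split => // w hw.
by rewrite -E // H.
Qed.

Lemma chain_rep_widen1 k phi t : chain_rep k phi t -> chain_rep k.+1 phi false.
Proof.
move=> [Q [B [Q0 _ H]]].
pose B' j := if (0 < j <= k.*2.+1)%N then B j.-1 else 0.
exists Q, B'; split => //; first by rewrite /B' doubleS /= ltnn eqxx.
move=> w /H ->; rewrite doubleS [RHS]big_ord_recl [X in _ = _ + X]big_ord_recr /=.
rewrite /B' /= /bump /= !add1n ltnn !horner0 !mul0r add0r addr0; apply: eq_bigr => j _.
rewrite ?ltnS -ltnS ltn_ord /= add0n; congr (_ * G (w + _%:C)).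
by rewrite -!natr1; ring.
Qed.

Lemma chain_rep_widen k n phi t : (k < n)%N -> chain_rep k phi t ->
  chain_rep n phi false.
Proof.
move=> kn H; rewrite -(subnKC kn); elim: (n - k.+1)%N => [|m IH].
  by rewrite addn0; exact: chain_rep_widen1 H.
by rewrite addnS; exact: chain_rep_widen1 IH.
Qed.

Lemma chain_repD k phi psi t : chain_rep k phi false -> chain_rep k psi t ->
  chain_rep k (fun w => phi w + psi w) t.
Proof.
move=> [Q1 [B1 [Q10 /negbFE/eqP B10 H1]]] [Q2 [B2 [Q20 B2t H2]]].
exists (Q1 * Q2), (fun j => Q2 * B1 j + Q1 * B2 j); split.
- by rewrite mulf_neq0.
- by rewrite B10 mulr0 add0r mulf_eq0 (negPf Q10).
move=> w hw; rewrite hornerM mulrDr mulrAC H1 // -mulrA H2 //.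
rewrite mulr_suml mulr_sumr -big_split /=; apply: eq_bigr => j _.
by rewrite hornerD !hornerM; ring.
Qed.

Lemma chain_repM k phi t (a : {poly C}) : a != 0 -> chain_rep k phi t ->
  chain_rep k (fun w => a.[ccosh w] * phi w) t.
Proof.
move=> a0 [Q [B [Q0 Bt H]]].
have [A [d [/(_ a0) A0 HA]]] := poly_joukowski a.
exists ('X^d * Q), (fun j => A * B j); split.
- by rewrite mulf_neq0 // monic_neq0 // monicXn.
- by rewrite mulf_eq0 (negPf A0).
move=> w hw; rewrite hornerM hornerXn /ccosh.
have -> : expc w ^+ d * Q.[expc w] * (a.[joukowski (expc w)] * phi w) =
    (expc w ^+ d * a.[joukowski (expc w)]) * (Q.[expc w] * phi w) by ring.
rewrite -HA ?expc_neq0 // H // mulr_sumr; apply: eq_bigr => j _.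
by rewrite hornerM mulrA.
Qed.

Lemma comp_scale_neq0 (c : C) (p : {poly C}) : c != 0 -> p != 0 ->
  p \Po (c *: 'X) != 0.
Proof.
move=> c0 p0; rewrite -size_poly_eq0 size_comp_poly2 ?size_poly_eq0 //.
by rewrite size_scale // size_polyX.
Qed.

(** The radius grows by one at each application of the operator; the new end
    coefficient is a product of the old one, shifted, with nonzero factors. *)
Lemma chain_rep_Dq k : chain_rep k (fun w => iter k (Dq q) y (ccosh w)) true.
Proof.
elim: k => [|k [Q [B [Q0 B0 H]]]].
  exists 1, (fun=> 1); split; rewrite ?oner_eq0 // => w _.
  by rewrite double0 big_ord1 /= subrr mul0r addr0.
have v0 : v%:C != 0 :> C by rewrite eq_complex /= negb_and gt_eqF ?sqrtq_gt0.
have vV0 : v%:C^-1 != 0 :> C by rewrite invr_eq0.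
pose up (p : {poly C}) := p \Po (v%:C *: 'X).
pose dn (p : {poly C}) := p \Po (v%:C^-1 *: 'X).
have upE p w : (up p).[expc w] = p.[expc (w + lam%:C)].
  by rewrite horner_comp hornerZ hornerX expc_shift.
have dnE p w : (dn p).[expc w] = p.[expc (w - lam%:C)].
  by rewrite horner_comp hornerZ hornerX expc_shiftN.
have v2 : (v%:C - v%:C^-1) / 2 != 0 :> C.
  rewrite mulf_neq0 ?invr_eq0 ?pnatr_eq0 // subr_eq0.
  apply/negP => /eqP /(congr1 (fun x => x * v%:C)); rewrite mulVf // => /eqP.
  rewrite -rmorphM -(rmorph1 (real_complex R)) (inj_eq (@complexI _)) => /eqP E.
  have := mulr_ilt1 (ltW sqrtq_gt0) (ltW sqrtq_gt0) sqrtq_lt1 sqrtq_lt1.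
  by rewrite E ltxx.
pose B' j := 'X * (dn Q * (if (1 < j)%N then up (B j.-2) else 0)) -
             'X * (up Q * (if (j < k.*2.+1)%N then dn (B j) else 0)).
exists (('X^2 - 1) * ((v%:C - v%:C^-1) / 2)%:P * (up Q * dn Q)), B'; split.
- rewrite !mulf_neq0 ?polyC_eq0 ?comp_scale_neq0 //.
  by rewrite -size_poly_eq0 -[1]/(1%:P) size_XnsubC.
- rewrite /B' doubleS /= ltnNge leqnSn /= mulr0 mulr0 subr0.
  by rewrite !mulf_neq0 ?polyX_eq0 ?comp_scale_neq0 // B0.
move=> w hw.
have -> : (('X^2 - 1) * ((v%:C - v%:C^-1) / 2)%:P * (up Q * dn Q)).[expc w] *
    iter k.+1 (Dq q) y (ccosh w) =
    (up Q).[expc w] * (dn Q).[expc w] * ((expc w ^+ 2 - 1) *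
      ((v%:C - v%:C^-1) / 2) * Dq q (iter k (Dq q) y) (ccosh w)).
  by rewrite !hornerM hornerC hornerD hornerN hornerXn hornerC /=; ring.
rewrite Dq_ccosh // mulrBr mulrBr.
have -> : (up Q).[expc w] * (dn Q).[expc w] *
    (expc w * iter k (Dq q) y (ccosh (w + lam%:C))) =
    expc w * (dn Q).[expc w] * ((up Q).[expc w] * iter k (Dq q) y (ccosh (w + lam%:C))).
  by ring.
have -> : (up Q).[expc w] * (dn Q).[expc w] *
    (expc w * iter k (Dq q) y (ccosh (w - lam%:C))) =
    expc w * (up Q).[expc w] * ((dn Q).[expc w] * iter k (Dq q) y (ccosh (w - lam%:C))).
  by ring.
rewrite {1}upE H; last exact: off_latticeDlam.
rewrite {2}dnE H; last exact: off_latticeBlam.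
rewrite doubleS.
under [RHS]eq_bigr do rewrite /B' hornerD hornerN mulrBl.
rewrite sumrB; congr (_ - _).
  rewrite [RHS]big_ord_recl [X in _ = _ + X]big_ord_recl /=.
  rewrite !mulr0 !horner0 !mul0r !add0r mulr_sumr.
  apply: eq_bigr => j _; rewrite /bump /= !add1n !hornerM hornerX upE /= add0n.
  rewrite -!mulrA; do 3 congr (_ * _); congr (G _).
  by rewrite -addrA -rmorphD; congr (_ + _%:C); rewrite -!natr1; ring.
rewrite [RHS]big_ord_recr [X in _ = X + _]big_ord_recr /=.
rewrite ltnn [(k.*2.+2 < _)%N]ltnNge leqnSn /= !mulr0 !horner0 !mul0r !addr0 mulr_sumr.
apply: eq_bigr => j _; rewrite ltn_ord !hornerM hornerX dnE.
rewrite -!mulrA; do 3 congr (_ * _); congr (G _).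
by rewrite -addrA -rmorphN -rmorphD; congr (_ + _%:C); rewrite -!natr1; ring.
Qed.

(** The end of the chain of radius [n] is reached by the term of order [n]
    alone, so the q-difference equation is not trivial. *)
Lemma qdifference_equation n (a : 'I_n.+1 -> {poly C}) : a ord_max != 0 ->
  (forall x, \sum_(k < n.+1) (a k).[x] * iter k (Dq q) y x = 0) ->
  exists B : nat -> {poly C}, B n.*2 != 0 /\
    forall w, off_lattice w ->
      \sum_(j < n.*2.+1) (B j).[expc w] * G (w + ((j%:R - n%:R) * lam)%:C) = 0.
Proof.
move=> an sol.
have low (s : seq 'I_n.+1) : (forall k, k \in s -> (k < n)%N) -> chain_rep n
    (fun w => \sum_(k <- s) (a k).[ccosh w] * iter k (Dq q) y (ccosh w)) false.
  elim: s => [|k s IH] hs.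
    by apply: eq_chain_rep (chain_rep0 n) => w _; rewrite big_nil.
  pose phi w := (a k).[ccosh w] * iter k (Dq q) y (ccosh w).
  have hphi : chain_rep n phi false.
    have kn : (k < n)%N by apply: hs; rewrite mem_head.
    rewrite /phi; have [->|ak] := eqVneq (a k) 0.
      by apply: eq_chain_rep (chain_rep0 n) => w _; rewrite horner0 mul0r.
    exact: chain_rep_widen kn (chain_repM ak (chain_rep_Dq k)).
  have hs' k' : k' \in s -> (k' < n)%N by move=> k's; apply: hs; rewrite in_cons k's orbT.
  apply: eq_chain_rep (chain_repD hphi (IH hs')) => w _.
  by rewrite big_cons.
pose s := [seq k : 'I_n.+1 <- index_enum 'I_n.+1 | (k < n)%N].
have hs k : k \in s -> (k < n)%N by rewrite mem_filter => /andP[].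
have [Q [B [Q0 Bt H]]] := chain_repD (low s hs) (chain_repM an (chain_rep_Dq n)).
exists B; split => // w hw; rewrite -H // big_filter.
apply/eqP; rewrite mulf_eq0; apply/orP; right; apply/eqP.
rewrite -[RHS](sol (ccosh w)) [RHS](bigD1 ord_max) //= [RHS]addrC; congr (_ + _).
apply: eq_bigl => k.
by rewrite -val_eqE /= ltn_neqAle -ltnS ltn_ord andbT.
Qed.

End Representation.
End QDifference.
(** * Log-order and growth *)
Section Growth.
Variable R : realType.
Local Notation C := R[i].

Lemma polar (x : C) : exists2 t : R, - pi <= t <= pi & x = (normc x)%:C * cis t.
Proof.
have pp := @pi_ge0 R.
have [->|x0] := eqVneq x 0.
  by exists 0; rewrite ?oppr_le0 ?pp // normc0 mul0r.
have n0 : 0 < normc x by rewrite normc_gt0.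
pose c := complex.Re x / normc x.
have cb : -1 <= c <= 1.
  rewrite -ler_norml /c normrM normfV (gtr0_norm n0) ler_pdivrMr // mul1r.
  exact: Re_le_normc.
have c0 := acos_ge0 cb; have c1 := acos_lepi cb.
have cosE : normc x * cos (acos c) = complex.Re x.
  by rewrite acosK ?in_itv //= /c mulrCA mulfV ?gt_eqF // mulr1.
have sinE : normc x * sin (acos c) = `|complex.Im x|.
  rewrite sin_acos // -[normc x in LHS](ger0_norm (ltW n0)) -sqrtr_sqr.
  rewrite -sqrtrM ?sqr_ge0 // -sqrtr_sqr; congr Num.sqrt.
  have -> : normc x ^+ 2 = complex.Re x ^+ 2 + complex.Im x ^+ 2.
    by case: (x) => a b /=; rewrite sqr_sqrtr // addr_ge0 ?sqr_ge0.
  have -> : c ^+ 2 = complex.Re x ^+ 2 / (complex.Re x ^+ 2 + complex.Im x ^+ 2).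
    rewrite /c exprMn exprVn; congr (_ / _).
    by case: (x) => a b /=; rewrite sqr_sqrtr // addr_ge0 ?sqr_ge0.
  field; rewrite gt_eqF //.
  have : 0 < normc x ^+ 2 by rewrite exprn_gt0.
  by case: (x) => a b /=; rewrite sqr_sqrtr // addr_ge0 ?sqr_ge0.
have [i0|i0] := leP 0 (complex.Im x).
  exists (acos c); first by rewrite c1 (le_trans _ c0) // oppr_le0.
  rewrite cisE; apply/eqP; rewrite eq_complex; simpc => /=.
  by rewrite cosE sinE ger0_norm // !eqxx.
exists (- acos c); first by rewrite lerN2 c1 (le_trans _ pp) // oppr_le0.
rewrite cisE cosN sinN; apply/eqP; rewrite eq_complex; simpc => /=.
by rewrite ?mulrN cosE sinE ltr0_norm // opprK !eqxx.
Qed.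

(** Boundedness matters because [maxmod] is a supremum, which is a default value
    on unbounded sets. *)
Lemma circle_bounded (y : C -> C) (r : R) : hol y ->
  exists B, forall x, normc x = r -> normc (y x) <= B.
Proof.
move=> hy.
have hG : hol (fun w => y (r%:C * expc w)).
  exact: hol_comp (holM (@hol_cst _ _) (@hol_expc _)) hy.
have pp : - pi <= pi :> R by rewrite ge0_cp // pi_ge0.
have [B HB] := ccontinuous_bounded pp (hol_ccontinuous 0 'i%C hG).
exists B => x xr; have [t ht xE] := polar x.
by have := HB t ht; rewrite add0r -/(cis t) -xr -xE.
Qed.

Lemma le_maxmod (y : C -> C) (x : C) : hol y -> normc (y x) <= maxmod y (normc x).
Proof.
move=> hy; have [B HB] := circle_bounded (normc x) hy.
apply: ub_le_sup; last by exists x.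
by exists B => _ [u /= ux <-]; exact: HB.
Qed.

(** A limit superior below [2] leaves room to beat any constant factor of
    [ln (normc x) ^+ 2]. *)
Lemma log_order_lt2_growth (y : C -> C) : hol y -> (log_order y < 2%:E)%E ->
  forall eta : R, 0 < eta -> exists r0 : R, forall x, r0 <= normc x ->
    normc (y x) <= expR (eta * ln (normc x) ^+ 2).
Proof.
move=> hy; rewrite /log_order limf_esupE => /ereal_inf_lt [_ [V HV <-] supV] eta eta0.
set f := fun r : R => _ in supV.
have [sigma s2 Hs] : exists2 sigma : R, sigma < 2 &
    forall r, V r -> lnp (lnp (maxmod y r)) / ln (ln r) <= sigma.
  have fle r : V r -> (f r <= ereal_sup (f @` V))%E.
    by move=> Vr; apply: ereal_sup_ubound; exists r.
  (* The supremum may be infinite below, in which case any bound will do. *)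
  move: supV fle; case: ereal_sup => [c|//|] /=.
    by rewrite lte_fin => c2 fle; exists c => // r /fle; rewrite /f lee_fin.
  move=> _ fle; exists 0; first by [].
  by move=> r /fle; rewrite /f leeNy_eq.
have [M [_ HM]] := HV.
pose T := Num.max 1 (- ln eta / (2 - sigma)).
exists (Num.max (M + 1) (expR (expR T))) => x; set r := normc x.
rewrite ge_max => /andP[rM rT].
have r0 : 0 < r by apply: lt_le_trans rT; exact: expR_gt0.
have lr : expR T <= ln r by rewrite -ler_expR lnK // posrE.
have lr0 : 0 < ln r by apply: lt_le_trans lr; exact: expR_gt0.
have llr : T <= ln (ln r) by rewrite -ler_expR lnK // posrE.
have [T1 T2] : 1 <= ln (ln r) /\ - ln eta / (2 - sigma) <= ln (ln r).
  by move: llr; rewrite ge_max => /andP[].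
have t0 : 0 < ln (ln r) by apply: lt_le_trans T1.
have := Hs r (HM r _); rewrite (lt_le_trans _ rM) ?ltrDl // => /(_ isT).
rewrite ler_pdivrMr // => H1.
have H2 : lnp (lnp (maxmod y r)) <= ln eta + 2 * ln (ln r).
  apply: le_trans H1 _; rewrite ler_pdivrMr ?subr_gt0 // in T2.
  by move: T2; set t := ln (ln r); rewrite mulrBr; lra.
have H3 : lnp (maxmod y r) <= eta * ln r ^+ 2.
  have [A0|A0] := leP (lnp (maxmod y r)) 0.
    by rewrite (le_trans A0) // mulr_ge0 ?sqr_ge0 // ltW.
  rewrite -ler_ln ?posrE ?mulr_gt0 ?exprn_gt0 //.
  rewrite lnM ?posrE ?exprn_gt0 // lnXn // -mulr_natl.
  by apply: le_trans H2; rewrite /lnp le_max lexx.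
have [->|yx0] := eqVneq (y x) 0; first by rewrite normc0 expR_ge0.
have ny0 : 0 < normc (y x) by rewrite normc_gt0.
have yM := le_maxmod x hy; rewrite -/r in yM.
rewrite -[normc (y x)]lnK ?posrE // ler_expR; apply: le_trans H3.
by rewrite /lnp le_max ler_ln ?posrE ?(lt_le_trans ny0) // yM.
Qed.

End Growth.
(** * Chebyshev coefficients of an entire function *)
Section Coefficients.
Variable R : realType.
Local Notation C := R[i].
Variable y : C -> C.
Hypothesis hy : hol y.

Let G w := y (ccosh w).

Lemma ccoshE (w : C) : ccosh w = (expc w + expc (- w)) / 2.
Proof. by rewrite /ccosh /joukowski expcN. Qed.

Lemma ccoshN (w : C) : ccosh (- w) = ccosh w.
Proof. by rewrite !ccoshE opprK addrC. Qed.

Lemma expc_period (w : C) : expc (w + 'i%C * (2 * pi)%:C) = expc w.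
Proof. by rewrite expcD -/(cis _) cis2pi mulr1. Qed.

Lemma expcN_period (w : C) : expc (- (w + 'i%C * (2 * pi)%:C)) = expc (- w).
Proof. by rewrite !expcN expc_period. Qed.

Lemma hol_expcN : hol (fun w : C => expc (- w)).
Proof.
have hN : hol (fun w : C => - w).
  rewrite (_ : (fun _ => _) = fun w : C => (-1) * w).
    exact: holM (@hol_cst _ _) (@hol_id _).
  by apply/funext => w; rewrite mulN1r.
exact: hol_comp hN (@hol_expc _).
Qed.

Lemma hol_ccosh : hol (@ccosh R).
Proof.
rewrite (_ : @ccosh R = fun w => (expc w + expc (- w)) * 2^-1).
  exact: holM (holD (@hol_expc _) hol_expcN) (@hol_cst _ _).
by apply/funext => w; rewrite ccoshE.
Qed.

Lemma hol_G : hol G.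
Proof. exact: hol_comp hol_ccosh hy. Qed.

Lemma G_period w : G (w + 'i%C * (2 * pi)%:C) = G w.
Proof. by rewrite /G !ccoshE expc_period expcN_period. Qed.

Definition coef_integrand (k : nat) w := G w * expc (- w) ^+ k.

Lemma hol_coef_integrand k : hol (coef_integrand k).
Proof. exact: holM hol_G (holX _ hol_expcN). Qed.

Lemma coef_integrand_period k w :
  coef_integrand k (w + 'i%C * (2 * pi)%:C) = coef_integrand k w.
Proof. by rewrite /coef_integrand G_period expcN_period. Qed.

(** [2 pi] times the [k]-th Laurent coefficient of [y] in the Joukowski
    variable. *)
Definition coef (k : nat) : C :=
  cint (- pi) pi (fun t => coef_integrand k ('i%C * t%:C)).

Lemma coef_line s k :
  cint (- pi) pi (fun t => coef_integrand k (s%:C + 'i%C * t%:C)) = coef k.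
Proof.
rewrite (cint_vertical_shift s 0 (hol_coef_integrand k) (coef_integrand_period k)).
by congr cint; apply/funext => t; rewrite add0r.
Qed.

(** On the line of abscissa [s] the point [ccosh w] runs over an ellipse between
    the circles of radii [sinh s] and [cosh s]. *)
Lemma normc_ccosh_bounds (s t r0 : R) : 0 <= s -> 1 <= r0 -> 2 * r0 <= s ->
  r0 <= normc (ccosh (s%:C + 'i%C * t%:C)) <= expR s.
Proof.
move=> s0 r1 rs; set w := _ + _.
have rew : complex.Re w = s by rewrite /w; simpc.
have e1 : normc (expc w) = expR s by rewrite normc_expc rew.
have e2 : normc (expc (- w)) = expR (- s).
  by rewrite normc_expc; congr expR; rewrite -rew; case: (w).
have small : expR (- s) <= 1 by rewrite -expR0 ler_expR oppr_le0.
have big : 1 + s <= expR s := expR_ge1Dx s.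
have n2 : normc 2 = 2 :> R.
  by rewrite -(rmorph_nat (real_complex R)) normc_real ger0_norm.
rewrite ccoshE normcM normcV n2 ler_pdivlMr // ler_pdivrMr //; apply/andP; split.
  have := normcB_le (expc w + expc (- w)) (expc (- w)).
  rewrite addrK e1 e2 => h; lra.
apply: le_trans (normcD_le _ _) _; rewrite e1 e2; lra.
Qed.

Hypothesis growth : forall eta : R, 0 < eta -> exists r0 : R,
  forall x, r0 <= normc x -> normc (y x) <= expR (eta * ln (normc x) ^+ 2).

(** Cauchy's estimate on the line of abscissa [T m], with [T] large. *)
Lemma coef_decay (D : R) : 1 <= D -> exists N, forall m, (N <= m)%N ->
  normc (coef m) * D ^+ (m ^ 2) <= 1.
Proof.
move=> D1; have D0 : 0 < D by rewrite (lt_le_trans ltr01).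
(* With [s = T * m] the estimate is [expR (- (T / 2) * m ^ 2)] up to a constant;
   this [T] leaves [expR (- m ^ 2)] after multiplication by [D ^+ (m ^ 2)]. *)
pose T := 2 * (ln D + 1).
have lD : 0 <= ln D by rewrite ln_ge0.
have T2 : 2 <= T by rewrite /T; lra.
have T0 : 0 < T by lra.
have eta0 : 0 < 1 / (2 * T) by rewrite divr_gt0 // mulr_gt0.
have [r0' Hr'] := growth eta0.
pose r0 := Num.max 1 r0'.
have r1 : 1 <= r0 by rewrite le_max lexx.
have Hr x : r0 <= normc x -> normc (y x) <= expR (1 / (2 * T) * ln (normc x) ^+ 2).
  by rewrite ge_max => /andP[_]; exact: Hr'.
exists (Num.bound (r0 + 4 * pi)) => m hm.
have pi0 := @pi_ge0 R.
have mr : r0 + 4 * pi <= m%:R.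
  apply: ltW; apply: lt_le_trans (archi_boundP _) _; last by rewrite ler_nat.
  by rewrite addr_ge0 // ?mulr_ge0 // (le_trans ler01).
have m1 : 1 <= m%:R :> R by rewrite (le_trans _ mr) // (le_trans r1) // lerDl mulr_ge0.
pose s := T * m%:R.
have s2 : 2 * r0 <= s by apply: ler_pM => //; [lra|rewrite (le_trans _ mr) // lerDl mulr_ge0].
have s0 : 0 <= s by rewrite mulr_ge0 // ltW.
have pp : - pi <= pi :> R by rewrite ge0_cp.
have bnd t : normc (coef_integrand m (s%:C + 'i%C * t%:C)) <=
    expR (- (ln D + 1) * m%:R ^+ 2).
  have /andP[c1 c2] := normc_ccosh_bounds t s0 r1 s2.
  rewrite /coef_integrand normcM normcX normc_expc.
  have -> : complex.Re (- (s%:C + 'i%C * t%:C)) = - s by simpc.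
  rewrite -expRM_natl; apply: le_trans (_ : expR (1 / (2 * T) * s ^+ 2) * expR (m%:R * - s) <= _).
    rewrite ler_wpM2r ?expR_ge0 //; apply: le_trans (Hr _ c1) _.
    set x := normc _ in c1 c2 *.
    have l0 : 0 <= ln x by rewrite ln_ge0 // (le_trans r1).
    have ls : ln x <= s.
      by rewrite -ler_expR lnK // posrE (lt_le_trans _ c1) // (lt_le_trans ltr01).
    by rewrite ler_expR ler_wpM2l ?(ltW eta0) // ler_pXn2r ?nnegrE.
  rewrite -expRD ler_expR le_eqVlt; apply/orP; left; apply/eqP.
  rewrite /s /T; field; rewrite gt_eqF //; lra.
have := normc_cint_le_cst pp (hol_ccontinuous s%:C 'i%C (hol_coef_integrand m))
  (fun t _ => bnd t).
rewrite coef_line opprK => le.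
have -> : D ^+ (m ^ 2) = expR (ln D * m%:R ^+ 2).
  by rewrite -natrX mulrC expRM_natl lnK.
apply: le_trans (ler_wpM2r (expR_ge0 _) le) _.
rewrite -!mulrA -expRD.
have -> : - (ln D + 1) * m%:R ^+ 2 + ln D * m%:R ^+ 2 = - (m%:R ^+ 2) by ring.
rewrite expRN !mulrA ler_pdivrMr ?expR_gt0 // mul1r.
apply: le_trans (expR_ge1Dx _).
apply: le_trans (_ : m%:R <= _); first by move: mr; lra.
by rewrite ler_wpDl // expr2 ler_peMr // (le_trans ler01).
Qed.

End Coefficients.
(** * The recurrence satisfied by the coefficients *)
Section CoefRecurrence.
Variables (R : realType) (q : R).
Hypotheses (hq0 : 0 < q) (hq1 : q < 1).
Local Notation C := R[i].
Local Notation v := (Num.sqrt q).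
Local Notation lam := (lam q).
Variable y : C -> C.
Hypothesis hy : hol y.

Let G w := y (ccosh w).

Variables (n : nat) (B : nat -> {poly C}).
Hypothesis B0 : B n.*2 != 0.
Hypothesis eqB : forall w, off_lattice q w ->
  \sum_(j < n.*2.+1) (B j).[expc w] * G (w + ((j%:R - n%:R) * lam)%:C) = 0.

Lemma expR_shift (j : nat) k :
  expR ((j%:R - n%:R) * lam) ^+ k = (v ^+ k) ^+ j * (v ^- n) ^+ k.
Proof.
rewrite mulrBl expRD expRN !expRM_natl expR_lam // exprMn; congr (_ * _).
by rewrite -!exprM mulnC.
Qed.

(** Integrating the q-difference equation against [expc (- w) ^+ m] along one
    line; each shifted term is moved back by a contour shift. *)
Lemma coef_recurrence L : (forall j, (j <= n.*2)%N -> (size (B j) <= L.+1)%N) ->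
  forall m, (L <= m)%N ->
  \sum_(l < L.+1) (\poly_(j < n.*2.+1) (B j)`_l).[(v ^+ (m - l))%:C] *
    (((v ^- n) ^+ (m - l))%:C * coef y (m - l)) = 0.
Proof.
move=> sB m Lm.
(* A line that avoids the lattice of multiples of [lam]. *)
pose s := lam / 2.
have off t : off_lattice q (s%:C + 'i%C * t%:C).
  move=> j; have -> : complex.Re (s%:C + 'i%C * t%:C) = s by simpc.
  apply/eqP => E; have lam0 := lam_neq0 hq0 hq1.
  have /(mulIf lam0) : (2^-1 : R) * lam = j%:~R * lam by rewrite -E mulrC.
  move/(congr1 (fun x => x * 2)); rewrite mulVf // => /eqP.
  rewrite -[2]/(2%:~R) -intrM -[1]/(1%:~R) eqr_int => /eqP; lia.
pose term (j l : nat) w := (B j)`_l * (expR ((j%:R - n%:R) * lam) ^+ (m - l))%:C *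
   coef_integrand y (m - l) (w + ((j%:R - n%:R) * lam)%:C).
have termE j l w : (l <= m)%N -> term j l w = expc (- w) ^+ m *
    ((B j)`_l * expc w ^+ l * G (w + ((j%:R - n%:R) * lam)%:C)).
  move=> lm; rewrite /term /coef_integrand -/(G _) opprD expcD exprMn.
  rewrite -[in RHS](subnK lm) [in RHS]exprD.
  have e1 : expc (- w) ^+ l * expc w ^+ l = 1.
    by rewrite -exprMn -expcD addNr expc0 expr1n.
  have e2 : (expR ((j%:R - n%:R) * lam) ^+ (m - l))%:C *
      expc (- ((j%:R - n%:R) * lam)%:C) ^+ (m - l) = 1.
    by rewrite rmorphXn /= -exprMn -expc_real -expcD subrr expc0 expr1n.
  set e := expc (- w) ^+ (m - l); set g := G _.
  transitivity ((B j)`_l * g * e); last by rewrite -[LHS]mulr1 -e1; ring.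
  by rewrite -[RHS]mulr1 -e2; ring.
have cc j l : ccontinuous (fun t => term j l (s%:C + 'i%C * t%:C)).
  apply: ccontinuousM (@ccontinuous_cst _ _) _.
  have := hol_ccontinuous (s%:C + ((j%:R - n%:R) * lam)%:C) 'i%C
    (hol_coef_integrand hy (m - l)).
  rewrite (_ : (fun _ => _) = fun t => coef_integrand y (m - l)
    (s%:C + 'i%C * t%:C + ((j%:R - n%:R) * lam)%:C)) //.
  by apply/funext => t; rewrite addrAC.
have I0 : cint (- pi) pi (fun t => \sum_(l < L.+1) \sum_(j < n.*2.+1)
    term j l (s%:C + 'i%C * t%:C)) = 0.
  have pp : - pi <= pi :> R by rewrite ge0_cp // pi_ge0.
  rewrite -[RHS](mulr0 (pi - - pi)%:C) -(cint_cst _ pp); congr cint.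
  apply/funext => t; set w := _ + _.
  rewrite exchange_big /=.
  transitivity (expc (- w) ^+ m * \sum_(j < n.*2.+1)
      (B j).[expc w] * G (w + ((j%:R - n%:R) * lam)%:C)).
    rewrite mulr_sumr; apply: eq_bigr => j _.
    rewrite (horner_coef_wide _ (sB j _)); last by rewrite -ltnS ltn_ord.
    rewrite mulr_suml mulr_sumr; apply: eq_bigr => l _; apply: termE.
    by rewrite (leq_trans _ Lm) // -ltnS ltn_ord.
  by rewrite eqB ?mulr0 //; exact: off.
rewrite -[RHS]I0 cint_sum => [|l]; last by apply: ccontinuous_sum => j.
apply: eq_bigr => l _; rewrite cint_sum // horner_poly mulr_suml.
apply: eq_bigr => j _; rewrite /term cintZ; last first.
  have := hol_ccontinuous (s%:C + ((j%:R - n%:R) * lam)%:C) 'i%C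
    (hol_coef_integrand hy (m - l)).
  rewrite (_ : (fun _ => _) = fun t => coef_integrand y (m - l)
    (s%:C + 'i%C * t%:C + ((j%:R - n%:R) * lam)%:C)) //.
  by apply/funext => t; rewrite addrAC.
have -> : (fun t : R => coef_integrand y (m - l)
    (s%:C + 'i%C * t%:C + ((j%:R - n%:R) * lam)%:C)) =
    fun t => coef_integrand y (m - l) ((s + (j%:R - n%:R) * lam)%:C + 'i%C * t%:C).
  by apply/funext => t; rewrite rmorphD addrAC.
rewrite coef_line // expR_shift rmorphM [in RHS]rmorphXn !mulrA.
by [].
Qed.

Hypothesis growth : forall eta : R, 0 < eta -> exists r0 : R,
  forall x, r0 <= normc x -> normc (y x) <= expR (eta * ln (normc x) ^+ 2).

Lemma coef_eventually0 : exists N, forall k, (N <= k)%N -> coef y k = 0.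
Proof.
have v0 := sqrtq_gt0 hq0; have v1 := sqrtq_lt1 hq1.
pose L := (\max_(j < n.*2.+1) size (B j))%N.
have sB j : (j <= n.*2)%N -> (size (B j) <= L.+1)%N.
  rewrite -ltnS => jn; apply: leqW.
  exact: (@leq_bigmax _ (fun j : 'I_n.*2.+1 => size (B j)) (Ordinal jn)).
pose P l := \poly_(j < n.*2.+1) (B j)`_l.
pose l0 := (size (B n.*2)).-1.
have l0L : (l0 <= L)%N.
  rewrite /l0; case: (size _) (sB _ (leqnn _)) => [|k] //=.
have Pl0 : P l0 != 0.
  apply: contra B0 => /eqP P0; rewrite -lead_coef_eq0 /lead_coef -/l0.
  have := coef_poly n.*2.+1 (fun j => (B j)`_l0) n.*2.
  by rewrite -/(P l0) P0 coef0 leqnn => <-.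
pose w := v ^- n.
have w1 : 1 <= w by rewrite -{1}[1]invr1 lef_pV2 ?posrE ?exprn_gt0 // exprn_ile1 // ltW.
have w0 : 0 < w by rewrite (lt_le_trans ltr01).
pose c k := (w ^+ k)%:C * coef y k.
have [D|N HN] := recurrence_vanish v0 v1 l0L Pl0 (c := c) (coef_recurrence sB).
  move=> D1.
  have DD : 1 <= w * D by rewrite mulr_ege1.
  have [N HN] := coef_decay hy growth DD.
  exists N => m /HN; apply: le_trans.
  rewrite /c normcM normc_real ger0_norm ?exprn_ge0 ?(ltW w0) //.
  rewrite exprMn [w ^+ _ * normc _]mulrC -mulrA ler_wpM2l ?normc_ge0 //.
  rewrite ler_wpM2r ?exprn_ge0 ?(le_trans ler01) //.
  by rewrite ler_weXn2l //; case: (m) => // k; nia.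
exists N => k /HN /eqP; rewrite /c mulf_eq0 => /orP[|/eqP //].
by rewrite eq_complex /= expf_eq0 gt_eqF // andbF.
Qed.

End CoefRecurrence.

(** * Functions with finitely many coefficients *)
Section FinitelyManyCoefs.
Variable R : realType.
Local Notation C := R[i].
Variable y : C -> C.
Hypothesis hy : hol y.

Lemma chebyshev_poly k : exists p : {poly C}, forall w,
  p.[ccosh w] = expc w ^+ k + expc (- w) ^+ k.
Proof.
(* Two consecutive polynomials at once, for the three-term recurrence. *)
suff [p [_ [Hp _]]] : exists p p' : {poly C},
    (forall w, p.[ccosh w] = expc w ^+ k + expc (- w) ^+ k) /\
    (forall w, p'.[ccosh w] = expc w ^+ k.+1 + expc (- w) ^+ k.+1).
  by exists p.
elim: k => [|k [p [p' [Hp Hp']]]].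
  exists 2%:P, ('X *+ 2); split=> w; first by rewrite hornerC !expr0 -natr1.
  by rewrite hornerMn hornerX ccoshE !expr1 -mulr_natr; field.
exists p', (('X *+ 2) * p' - p); split=> // w.
rewrite hornerD hornerN hornerM hornerMn hornerX Hp Hp' ccoshE expcN !exprS.
by field; rewrite expc_neq0.
Qed.

(** Subtracting the Chebyshev sum with the same coefficients leaves a function
    whose Fourier coefficients on every line vanish. *)
Lemma finite_coef_polynomial N : (forall k, (N <= k)%N -> coef y k = 0) ->
  exists p : {poly C}, forall x, y x = p.[x].
Proof.
move=> HN; have /choice[tp Htp] := chebyshev_poly.
have pp : - pi <= pi :> R by rewrite ge0_cp // pi_ge0.
(* [k = 0] is special as then [expc w ^+ k + expc (- w) ^+ k] is the constant
   [2]. *)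
pose d k := coef y k / (2 * pi * (1 + (k == 0%N)%:R))%:C.
pose P := \sum_(k < N) d k *: tp k.
pose H w := y (ccosh w) - P.[ccosh w].
have hP : hol (fun w => P.[ccosh w]).
  rewrite (_ : (fun _ => _) =
      fun w => \sum_(k < N) d k * (expc w ^+ k + expc (- w) ^+ k)).
    apply: hol_sum => k; apply: holM (@hol_cst _ _) _.
    exact: holD (holX _ (@hol_expc _)) (holX _ (@hol_expcN _)).
  apply/funext => w; rewrite horner_sum; apply: eq_bigr => k _.
  by rewrite hornerZ Htp.
have hG := hol_G hy.
have hH : hol H.
  rewrite (_ : H = fun w => y (ccosh w) + (-1) * P.[ccosh w]).
    exact: holD hG (holM (@hol_cst _ _) hP).
  by apply/funext => w; rewrite mulN1r.
have perc (w : C) : ccosh (w + 'i%C * (2 * pi)%:C) = ccosh w.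
  by rewrite !ccoshE expc_period expcN_period.
have perH w : H (w + 'i%C * (2 * pi)%:C) = H w by rewrite /H perc.
have ccE k m : cint (- pi) pi (fun t : R =>
    (cis t ^+ k + cis (- t) ^+ k) * cis (- t) ^+ m) =
    if k == m then (2 * pi * (1 + (k == 0%N)%:R))%:C else 0.
  rewrite (_ : (fun _ => _) = fun t => cis t ^+ k * cis (- t) ^+ m +
      cis t ^+ 0 * cis (- t) ^+ (k + m)); last first.
    by apply/funext => t; rewrite mulrDl exprD expr0 mul1r.
  rewrite cintD; [|exact: ccont_cis2|exact: ccont_cis2].
  rewrite !cint_cisX_cisNX; have [->|km] := eqVneq k m.
    case: m => [|m].
      by rewrite addn0 !eqxx (mulrDr _ 1) !mulr1 rmorphD.
    by rewrite /= addr0 addr0 mulr1.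
  case: eqP => [E|]; last by rewrite addr0.
  by move: km; have [-> ->] : k = 0%N /\ m = 0%N by lia.
have cP k : ccontinuous (fun t : R => cis t ^+ k + cis (- t) ^+ k).
  exact: ccontinuousD (ccontinuous_cisX _ k) (ccontinuous_cisNX _ k).
have neg0 m : cint (- pi) pi (fun t => H ('i%C * t%:C) * cis (- t) ^+ m) = 0.
  rewrite (_ : (fun _ => _) = fun t => coef_integrand y m (0 + 'i%C * t%:C) +
    \sum_(k < N) (- d k) * ((cis t ^+ k + cis (- t) ^+ k) * cis (- t) ^+ m)); last first.
    apply/funext => t; rewrite /H mulrBl add0r /coef_integrand.
    have -> : expc (- ('i%C * t%:C)) = cis (- t) by rewrite /cis rmorphN mulrN.
    congr (_ + _); rewrite horner_sum -mulNr -sumrN mulr_suml.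
    apply: eq_bigr => k _; rewrite hornerZ Htp -/(cis t) mulNr -mulrA -mulNr.
    by rewrite /cis rmorphN mulrN.
  have cc k : ccontinuous (fun t : R => - d k *
      ((cis t ^+ k + cis (- t) ^+ k) * cis (- t) ^+ m)).
    exact: ccontinuousM (@ccontinuous_cst _ _)
      (ccontinuousM (cP k) (ccontinuous_cisNX _ m)).
  rewrite cintD; last first.
  - exact: ccontinuous_sum.
  - exact: hol_ccontinuous (hol_coef_integrand hy m).
  rewrite (coef_line hy 0) cint_sum //.
  rewrite (eq_bigr (fun k : 'I_N => if k == m :> nat then - coef y m else 0)); last first.
    move=> k _; rewrite cintZ; last exact: ccontinuousM (cP k) (ccontinuous_cisNX _ m).
    rewrite ccE; case: eqP => [->|_]; last by rewrite mulr0.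
    have K0 : 0 < 2 * pi * (1 + (m == 0%N)%:R) :> R.
      by rewrite !mulr_gt0 ?pi_gt0 // ltr_wpDr.
    by rewrite /d mulNr mulfVK // eq_complex /= eqxx andbT gt_eqF.
  have [Nm|mN] := leqP N m.
    rewrite HN // add0r big1 // => k _; case: eqP => // km.
    by have := ltn_ord k; rewrite km ltnNge Nm.
  rewrite (bigD1 (Ordinal mN)) //= eqxx big1 ?addr0 ?subrr // => k km.
  by case: eqP => // E; case/eqP: km; apply: val_inj.
have evenH w : H (- w) = H w by rewrite /H ccoshN.
(* The other half of the coefficients follows from [H (- w) = H w]. *)
have pos0 m : cint (- pi) pi (fun t => H ('i%C * t%:C) * cis t ^+ m) = 0.
  pose F w := H w * expc (- w) ^+ m.
  have hF : hol F by apply: holM hH (holX _ (@hol_expcN _)).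
  have := neg0 m.
  have -> : (fun t => H ('i%C * t%:C) * cis (- t) ^+ m) =
      fun t : R => F (0 + 'i%C * t%:C).
    by apply/funext => t; rewrite /F add0r /cis rmorphN mulrN.
  rewrite -[X in cint _ X _]opprK cint_oppr //; last exact: hol_ccontinuous.
  move=> <-; congr cint; apply/funext => t.
  by rewrite /F add0r rmorphN mulrN opprK evenH.
have zero s t0 : - pi <= t0 <= pi -> H (s%:C + 'i%C * t0%:C) = 0.
  move=> ht; apply: (fourier_uniqueness hH perH ht) => m.
    pose F w := H w * expc w ^+ m.
    have hF : hol F by apply: holM hH (holX _ (@hol_expc _)).
    have perF w : F (w + 'i%C * (2 * pi)%:C) = F w by rewrite /F perH expc_period.
    rewrite (_ : (fun _ => _) = fun t => (expR (- s) ^+ m)%:C * F (s%:C + 'i%C * t%:C)).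
      rewrite cintZ; last exact: hol_ccontinuous.
      rewrite (cint_vertical_shift s 0 hF perF) -[X in _ * X](_ : 0 = _) ?mulr0 //.
      rewrite -(pos0 m); congr cint; apply/funext => t.
      by rewrite add0r.
    apply/funext => t; rewrite /F expcD exprMn expc_real -rmorphXn.
    rewrite mulrCA; congr (_ * _).
    by rewrite mulrA -rmorphM -exprMn -expRD addNr expR0 expr1n mul1r.
  pose F w := H w * expc (- w) ^+ m.
  have hF : hol F by apply: holM hH (holX _ (@hol_expcN _)).
  have perF w : F (w + 'i%C * (2 * pi)%:C) = F w by rewrite /F perH expcN_period.
  rewrite (_ : (fun _ => _) = fun t => (expR s ^+ m)%:C * F (s%:C + 'i%C * t%:C)).
    rewrite cintZ; last exact: hol_ccontinuous.
    rewrite (cint_vertical_shift s 0 hF perF) -[X in _ * X](_ : 0 = _) ?mulr0 //.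
    rewrite -(neg0 m); congr cint; apply/funext => t.
    by rewrite add0r /F /cis rmorphN mulrN.
  apply/funext => t; rewrite /F opprD expcD exprMn.
  rewrite -rmorphN expc_real -rmorphXn.
  rewrite mulrCA; congr (_ * _).
  rewrite mulrA -rmorphM -exprMn -expRD subrr expR0 expr1n mul1r.
  by rewrite /cis rmorphN mulrN.
exists P => x.
pose z := joukowski_inv x; have z0 : z != 0 := joukowski_inv_neq0 x.
have [t ht zE] := polar z.
have n0 : 0 < normc z by rewrite normc_gt0.
have E : ccosh ((ln (normc z))%:C + 'i%C * t%:C) = x.
  rewrite /ccosh expcD expc_real lnK ?posrE // -/(cis t) -zE.
  exact: joukowski_invK.
by have /eqP := zero (ln (normc z)) t ht; rewrite /H E subr_eq0 => /eqP.
Qed.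

End FinitelyManyCoefs.

(** * Entire solutions of Askey-Wilson equations *)

Theorem theorem6p2 (R : realType) (q : R) (hq0 : 0 < q) (hq1 : q < 1)
  (n : nat) (a : 'I_n.+1 -> {poly R[i]}) (han : a ord_max != 0)
  (y : R[i] -> R[i]) (hy : transcendental_entire y)
  (hsol : forall x : R[i],
     \sum_(k < n.+1) (a k).[x] * iter k (Dq q) y x = 0) :
  (2%:E <= log_order y)%E.
Proof.
rewrite leNgt; apply/negP => small.
case: hy => /entire_hol hol_y; apply.
have growth := log_order_lt2_growth hol_y small.
have [B [B0 eqB]] := qdifference_equation hq0 hq1 han hsol.
have [N HN] := coef_eventually0 hq0 hq1 hol_y B0 eqB growth.
exact: (finite_coef_polynomial hol_y HN).
Qed.
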